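(* Let $M^n\hookrightarrow\tilde M^{n+1}$ be an embedded hypersurface in a Riemannian manifold and $v$ a vector field on $M$. Then the scalar second fundamental form $h$ satisfies $$(\operatorname{div}h)(v)=nv(H)-\widetilde{\mathrm{Ric}}(v,N),$$ where $H$ is the mean curvature of $M$ and $N$ the unit normal. In general, for an embedded submanifold $M^n\hookrightarrow\tilde M^{n+k}$, $k\ge1$, $$(\operatorname{tr}\nabla^B\mathrm{II})(v)=n\nabla^\perp_v\mathbf H+\delta^{ij}(\tilde R(E_i,v)E_j)^\perp,$$ where $\{E_i\}$ is any orthonormal frame on $M$.
   Context: Everything is smooth. $(\tilde M,\tilde g)$ is a Riemannian manifold, $M$ carries the induced metric $g$; $\tilde\nabla,\nabla$ are the Levi-Civita connections of $\tilde M,M$; ${}^\perp$ is orthogonal projection onto the normal space of $M$. Repeated indices $i,j\in\{1,\dots,n\}$ are summed. $\mathrm{II}(X,Y)=(\tilde\nabla_XY)^\perp$; $\mathbf H=\frac1n\delta^{ij}\mathrm{II}(E_i,E_j)$ is the mean curvature vector; $\nabla^\perp_X\eta=(\tilde\nabla_X\eta)^\perp$ for normal fields $\eta$; for a normal-bundle-valued bilinear map $A$ on $TM$, $(\nabla^B_XA)(Y,Z)=\nabla^\perp_X(A(Y,Z))-A(\nabla_XY,Z)-A(Y,\nabla_XZ)$; $(\operatorname{tr}\nabla^B\mathrm{II})(v)=\delta^{ij}(\nabla^B_{E_i}\mathrm{II})(E_j,v)$. For a hypersurface with chosen (local) unit normal $N$: $h(X,Y)=\tilde g(N,\mathrm{II}(X,Y))$;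 $H=\frac1n\sum_ih(E_i,E_i)$; $(\operatorname{div}h)(v)=\sum_i(\nabla_{E_i}h)(E_i,v)$ for an ON frame $\{E_i\}$ of $M$. Curvature convention: $\tilde R(X,Y)Z=\tilde\nabla_X\tilde\nabla_YZ-\tilde\nabla_Y\tilde\nabla_XZ-\tilde\nabla_{[X,Y]}Z$, $\tilde R(W,X,Y,Z)=\tilde g(\tilde R(W,X)Y,Z)$, $\widetilde{\mathrm{Ric}}(X,Y)=\sum_\alpha\tilde R(E_\alpha,X,Y,E_\alpha)$ over an ON frame $\{E_\alpha\}$ of $\tilde M$. *)

(* Defs.v *)
From mathcomp Require Import all_boot all_order all_algebra.
From mathcomp Require Import all_classical all_reals all_analysis.

Set Implicit Arguments.
Unset Strict Implicit.
Unset Printing Implicit Defensive.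

Import Order.TTheory GRing.Theory Num.Theory.
Import numFieldNormedType.Exports.

Local Open Scope classical_set_scope.
Local Open Scope ring_scope.

Section Euclidean.
Context {R : realType} {n : nat} {W : normedModType R}.

Fixpoint Ck_on (k : nat) (U : set 'rV[R]_n) (f : 'rV[R]_n -> W) : Prop :=
  match k with
  | 0%N => forall x, U x -> {for x, continuous f}
  | k'.+1 => (forall x, U x -> differentiable f x) /\
             (forall v, Ck_on k' U ('D_v f))
  end.

Definition smooth_on (U : set 'rV[R]_n) (f : 'rV[R]_n -> W) : Prop :=
  forall k, Ck_on k U f.

Definition smooth_near (x : 'rV[R]_n) (f : 'rV[R]_n -> W) : Prop :=
  exists2 U, open_nbhs x U & smooth_on U f.

End Euclidean.

(* A homeomorphism from the open set csrc of M onto an open set of R^n; both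
   maps are total, with irrelevant values outside these two sets. *)
Record chart (R : realType) (n : nat) (M : topologicalType) := Chart {
  csrc : set M;
  cmap : M -> 'rV[R]_n;
  cinv : 'rV[R]_n -> M;
  csrc_open : open csrc;
  cimg_open : open (cmap @` csrc);
  cmapK : forall p, csrc p -> cinv (cmap p) = p;
  cmap_cont : forall p, csrc p -> {for p, continuous cmap};
  cinv_cont : forall x, (cmap @` csrc) x -> {for x, continuous cinv} }.

(* The smooth structure is given by an atlas indexed by the points of M: the
   chart number p contains p, and is the one in which the tangent space at p
   is coordinatized below.  Any smooth atlas can be presented in this way (pick
   a chart around each point). *)
Record manifold (R : realType) (n : nat) := Manifold {
  carrier :> topologicalType;
  manifold_hausdorff : hausdorff_space carrier;
  manifold_second_countable : @second_countable carrier;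
  chart_at : carrier -> chart R n carrier;
  chart_at_src : forall p, csrc (chart_at p) p;
  chart_compat : forall p q : carrier,
    smooth_on (cmap (chart_at p) @` (csrc (chart_at p) `&` csrc (chart_at q)))
              (cmap (chart_at q) \o cinv (chart_at p)) }.

Section Calculus.
Context {R : realType}.

Definition coord {n} {M : manifold R n} (p : M) : 'rV[R]_n :=
  cmap (chart_at p) p.

Definition smooth_at {n} {M : manifold R n} {W : normedModType R}
    (p : M) (f : M -> W) : Prop :=
  smooth_near (coord p) (f \o cinv (chart_at p)).

Definition smooth_map {m n} {M : manifold R m} {N : manifold R n}
    (F : M -> N) : Prop :=
  forall p, {for p, continuous F} /\
            smooth_at p (cmap (chart_at (F p)) \o F).

(* The tangent space T_pM is 'rV_n: the row x stands for the tangent vector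
   with components x in the coordinate basis of chart_at p.
   [dir p x f] is the action x(f) of that vector on a function f. *)
Definition dir {n} {M : manifold R n} (p : M) (x : 'rV[R]_n) (f : M -> R) : R :=
  'D_x (f \o cinv (chart_at p)) (coord p).

(* The differential dF_p : T_pM -> T_{F p}N. *)
Definition dmap {m n} {M : manifold R m} {N : manifold R n}
    (F : M -> N) (p : M) (x : 'rV[R]_m) : 'rV[R]_n :=
  'D_x (cmap (chart_at (F p)) \o F \o cinv (chart_at p)) (coord p).

Definition push {m n} {M : manifold R m} {N : manifold R n}
    (F : M -> N) (X : M -> 'rV[R]_m) : M -> 'rV[R]_n :=
  fun q => dmap F q (X q).

(* A vector field along F : M -> N assigns to q a vector of T_{F q}N; since
   the components of Y q refer to a chart that varies with q, smoothness is
   tested through the action on functions.  Vector fields on M are vector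
   fields along the identity. *)
Definition smooth_along {m n} {M : manifold R m} {N : manifold R n}
    (F : M -> N) (p : M) (Y : M -> 'rV[R]_n) : Prop :=
  forall f : N -> R, smooth_at (F p) f ->
    smooth_at p (fun q => dir (F q) (Y q) f).

Definition smooth_vf {n} {M : manifold R n} (p : M) (X : M -> 'rV[R]_n) : Prop :=
  smooth_along (fun q : M => q) p X.

(* [X, Y]_p, whose a-th component is X(Y x^a) - Y(X x^a) for the coordinate
   functions x^a of chart_at p. *)
Definition bracket {n} {M : manifold R n} (X Y : M -> 'rV[R]_n) (p : M) :
    'rV[R]_n :=
  \row_a (dir p (X p) (fun q => dir q (Y q) (fun r => cmap (chart_at p) r 0 a))
        - dir p (Y p) (fun q => dir q (X q) (fun r => cmap (chart_at p) r 0 a))).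

(* Extension of x in T_pM to a vector field near p with constant components in
   the coordinates of chart_at p. *)
Definition ext {n} {M : manifold R n} (p : M) (x : 'rV[R]_n) : M -> 'rV[R]_n :=
  fun q => 'D_x (cmap (chart_at q) \o cinv (chart_at p)) (cmap (chart_at p) q).

(* F is an injective immersion and M has the topology induced by F. *)
Record embedding {m n} {M : manifold R m} {N : manifold R n} (F : M -> N) :
    Prop := Embedding {
  embedding_smooth : smooth_map F;
  embedding_immersion : forall p, injective (dmap F p);
  embedding_inj : injective F;
  embedding_top : forall U : set M, open U ->
    exists2 V : set N, open V & U = F @^-1` V }.

End Calculus.

Section Riemannian.
Context {R : realType}.

Record riemannian_metric {n} {M : manifold R n}
    (g : M -> 'rV[R]_n -> 'rV[R]_n -> R) : Prop := RiemannianMetric {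
  metric_linear : forall p a x y z,
    g p (a *: x + y) z = a * g p x z + g p y z;
  metric_sym : forall p x y, g p x y = g p y x;
  metric_pos : forall p x, x != 0 -> 0 < g p x x;
  metric_smooth : forall p X Y, smooth_vf p X -> smooth_vf p Y ->
    smooth_at p (fun q => g q (X q) (Y q)) }.

Definition induced_metric {m n} {M : manifold R m} {N : manifold R n}
    (F : M -> N) (g : N -> 'rV[R]_n -> 'rV[R]_n -> R) :
    M -> 'rV[R]_m -> 'rV[R]_m -> R :=
  fun p x y => g (F p) (dmap F p x) (dmap F p y).

(* A connection on vector fields along F: [D p x Y] is the derivative of Y in
   the direction x in T_pM.  It is constrained only on fields smooth near p;
   the Leibniz rule makes it depend only on the germ of Y at p, since the
   indicator function of an open set containing p is smooth near p. *)
Record connection_along {m n} {M : manifold R m} {N : manifold R n}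
    (F : M -> N) (D : M -> 'rV[R]_m -> (M -> 'rV[R]_n) -> 'rV[R]_n) : Prop :=
  ConnectionAlong {
  connection_linear : forall p a x y Y, smooth_along F p Y ->
    D p (a *: x + y) Y = a *: D p x Y + D p y Y;
  connection_add : forall p x Y Z, smooth_along F p Y -> smooth_along F p Z ->
    D p x (fun q => Y q + Z q) = D p x Y + D p x Z;
  connection_leibniz : forall p x (f : M -> R) Y,
    smooth_at p f -> smooth_along F p Y ->
    D p x (fun q => f q *: Y q) = dir p x f *: Y p + f p *: D p x Y;
  connection_smooth : forall p X Y, smooth_vf p X -> smooth_along F p Y ->
    smooth_along F p (fun q => D q (X q) Y) }.

Record levi_civita {n} {M : manifold R n}
    (g : M -> 'rV[R]_n -> 'rV[R]_n -> R)
    (nabla : M -> 'rV[R]_n -> (M -> 'rV[R]_n) -> 'rV[R]_n) : Prop := LeviCivita {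
  levi_civita_connection : connection_along (fun p : M => p) nabla;
  levi_civita_torsion_free : forall p X Y, smooth_vf p X -> smooth_vf p Y ->
    nabla p (X p) Y - nabla p (Y p) X = bracket X Y p;
  levi_civita_metric : forall p x Y Z, smooth_vf p Y -> smooth_vf p Z ->
    dir p x (fun q => g q (Y q) (Z q)) =
    g p (nabla p x Y) (Z p) + g p (Y p) (nabla p x Z) }.

(* The action of a connection nabla of N on vector fields of N that are only
   defined along F (the pullback connection): the unique connection along F
   whose value on the restriction Z \o F of a vector field Z of N is
   nabla_{dF x} Z.  So D p x Y is nabla_{dF x} Z for any extension Z of Y. *)
Record pullback_connection {m n} {M : manifold R m} {N : manifold R n}
    (F : M -> N) (nabla : N -> 'rV[R]_n -> (N -> 'rV[R]_n) -> 'rV[R]_n)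
    (D : M -> 'rV[R]_m -> (M -> 'rV[R]_n) -> 'rV[R]_n) : Prop :=
  PullbackConnection {
  pullback_is_connection : connection_along F D;
  pullback_restrict : forall p x Z, smooth_vf (F p) Z ->
    D p x (Z \o F) = nabla (F p) (dmap F p x) Z }.

Definition curvature_vf {n} {M : manifold R n}
    (nabla : M -> 'rV[R]_n -> (M -> 'rV[R]_n) -> 'rV[R]_n)
    (X Y Z : M -> 'rV[R]_n) (p : M) : 'rV[R]_n :=
  nabla p (X p) (fun q => nabla q (Y q) Z)
  - nabla p (Y p) (fun q => nabla q (X q) Z)
  - nabla p (bracket X Y p) Z.

(* R(x, y)z for vectors at p, the curvature being a tensor. *)
Definition curvature {n} {M : manifold R n}
    (nabla : M -> 'rV[R]_n -> (M -> 'rV[R]_n) -> 'rV[R]_n)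
    (p : M) (x y z : 'rV[R]_n) : 'rV[R]_n :=
  curvature_vf nabla (ext p x) (ext p y) (ext p z) p.

Definition orthonormal {n m} {M : manifold R n}
    (g : M -> 'rV[R]_n -> 'rV[R]_n -> R) (p : M) (e : 'I_m -> 'rV[R]_n) : Prop :=
  forall i j, g p (e i) (e j) = (i == j)%:R.

Definition onb {n} {M : manifold R n}
    (g : M -> 'rV[R]_n -> 'rV[R]_n -> R) (p : M) : 'I_n -> 'rV[R]_n :=
  xget (fun _ => 0) [set e | orthonormal g p e].

Definition on_frame {n} {M : manifold R n}
    (g : M -> 'rV[R]_n -> 'rV[R]_n -> R) (U : set M)
    (E : 'I_n -> M -> 'rV[R]_n) : Prop :=
  forall p, U p ->
    (forall i, smooth_vf p (E i)) /\ orthonormal g p (fun i => E i p).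

Definition local_frame {n} {M : manifold R n}
    (g : M -> 'rV[R]_n -> 'rV[R]_n -> R) (p : M) : 'I_n -> M -> 'rV[R]_n :=
  xget (fun _ _ => 0) [set E | exists2 U, open_nbhs p U & on_frame g U E].

Definition ricci {n} {M : manifold R n}
    (g : M -> 'rV[R]_n -> 'rV[R]_n -> R)
    (nabla : M -> 'rV[R]_n -> (M -> 'rV[R]_n) -> 'rV[R]_n)
    (p : M) (x y : 'rV[R]_n) : R :=
  \sum_a g p (curvature nabla p (onb g p a) x y) (onb g p a).

End Riemannian.

(* Below, gt is meant to be the metric of N, nabla the Levi-Civita connection of
   M with the induced metric, and D the pullback along F of the Levi-Civita
   connection of N. *)

Section Submanifold.
Context {R : realType} {m n : nat} {M : manifold R m} {N : manifold R n}.
Variables (F : M -> N) (gt : N -> 'rV[R]_n -> 'rV[R]_n -> R).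
Variables (nabla : M -> 'rV[R]_m -> (M -> 'rV[R]_m) -> 'rV[R]_m).
Variables (D : M -> 'rV[R]_m -> (M -> 'rV[R]_n) -> 'rV[R]_n).

Definition is_normal (p : M) (w : 'rV[R]_n) : Prop :=
  forall x, gt (F p) w (dmap F p x) = 0.

Definition perp (p : M) (w : 'rV[R]_n) : 'rV[R]_n :=
  xget 0 [set u | is_normal p u /\ exists x, w = dmap F p x + u].

Definition II (X Y : M -> 'rV[R]_m) : M -> 'rV[R]_n :=
  fun p => perp p (D p (X p) (push F Y)).

(* The trace of II does not depend on the orthonormal frame. *)
Definition mean_curvature_vector : M -> 'rV[R]_n := fun p =>
  let E := local_frame (induced_metric F gt) p in
  (m%:R)^-1 *: \sum_(i < m) II (E i) (E i) p.

Definition nabla_perp (p : M) (x : 'rV[R]_m) (eta : M -> 'rV[R]_n) : 'rV[R]_n :=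
  perp p (D p x eta).

Definition nablaB (A : (M -> 'rV[R]_m) -> (M -> 'rV[R]_m) -> M -> 'rV[R]_n)
    (X Y Z : M -> 'rV[R]_m) : M -> 'rV[R]_n := fun p =>
  nabla_perp p (X p) (A Y Z)
  - A (fun q => nabla q (X q) Y) Z p
  - A Y (fun q => nabla q (X q) Z) p.

Definition tr_nablaB_II (E : 'I_m -> M -> 'rV[R]_m) (v : M -> 'rV[R]_m) :
    M -> 'rV[R]_n :=
  fun p => \sum_(i < m) nablaB II (E i) (E i) v p.

Variable nu : M -> 'rV[R]_n.

Definition unit_normal (U : set M) : Prop :=
  forall p, U p ->
    [/\ smooth_along F p nu, is_normal p (nu p) & gt (F p) (nu p) (nu p) = 1].

Definition h (X Y : M -> 'rV[R]_m) : M -> R :=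
  fun p => gt (F p) (nu p) (II X Y p).

Definition mean_curvature : M -> R := fun p =>
  let E := local_frame (induced_metric F gt) p in
  (m%:R)^-1 * \sum_(i < m) h (E i) (E i) p.

Definition nabla_h (X Y Z : M -> 'rV[R]_m) : M -> R := fun p =>
  dir p (X p) (h Y Z)
  - h (fun q => nabla q (X q) Y) Z p
  - h Y (fun q => nabla q (X q) Z) p.

Definition div_h (E : 'I_m -> M -> 'rV[R]_m) (v : M -> 'rV[R]_m) : M -> R :=
  fun p => \sum_(i < m) nabla_h (E i) (E i) v p.

End Submanifold.

(* Main.v *)
Require Import Defs.
From mathcomp Require Import all_boot all_order all_algebra.
From mathcomp Require Import all_classical all_reals all_analysis.
From mathcomp Require Import ring lra.
Set Implicit Arguments.
Unset Strict Implicit.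
Unset Printing Implicit Defensive.
Import Order.TTheory GRing.Theory Num.Theory.
Import numFieldNormedType.Exports.
Local Open Scope classical_set_scope.
Local Open Scope ring_scope.

(** Both formulas are traces of the Codazzi equation
      (nabla^B_X II)(Y, Z) - (nabla^B_Y II)(X, Z) = (Rt(X, Y) Z)^perp,
    lemma [codazzi].  Take X = Z = E_i and Y = v and sum over i.  Since II is
    symmetric, the first term becomes tr(nabla^B II)(v), and the second is
    the sum of the (nabla^B_v II)(E_i, E_i), which equals
    nabla^perp_v (sum_i II(E_i, E_i)) - 2 sum_i II(nabla_v E_i, E_i).  The last
    sum vanishes, because g(nabla_v E_i, E_j) is skew in i, j while
    II(E_i, E_j) is symmetric; and the sum of the II(E_i, E_i) is n times the
    mean curvature vector, whatever orthonormal frame computes the latter.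

    The Codazzi equation is the normal part of the statement that the
    connection D pulled back along the immersion F has the pulled back
    curvature, D_X D_Y W - D_Y D_X W - D_[X,Y] W = Rt(dF X, dF Y) W
    ([pullback_curvature]), applied to W = dF Z and combined with the Gauss
    decomposition D_Y (dF Z) = dF (nabla_Y Z) + II(Y, Z) ([IIE]).  For the
    latter, let S(X, Y, Z) be the inner product of
    D_X (dF Y) - dF (nabla_X Y) with dF Z.  Both connections are torsion free
    and metric, so S is symmetric in its first two arguments and skew in its
    last two, hence zero: this is Koszul's argument for the uniqueness of the
    Levi-Civita connection.

    The facts about D (curvature, torsion, compatibility with the metric) are
    all obtained by writing a field along F near p as a combination
    sum_a W^a (d_a o F), where the W^a are smooth functions and the d_a are the
    coordinate fields of the chart of the ambient manifold at F p
    ([along_expand], [smooth_along_ind]); on d_a o F the pullback connection is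
    the ambient one, and the Leibniz rule extends the identities.  Their
    analytic content is that a bracket acts on functions as a commutator
    ([dir_bracket]), which rests on the symmetry of second derivatives
    ([derive_commute]).

    For a hypersurface with unit normal N, the normal spaces are lines and
    D_X N is orthogonal to N, so h is differentiated as the inner product of N
    with the derivative of II.  The first formula is then the inner product of
    the second one with N: by the skew-symmetries of the curvature tensor, the
    sum of the Rt(E_i, v, E_i, N) is minus the Ricci curvature computed in the
    orthonormal basis (E_1, ..., E_n, N). *)

(** * Functions of class C^k on open subsets of R^n *)

Section NearEq.
Context {R : numFieldType} {V W : normedModType R}.

(** The remainder of the expansion with zero differential vanishes near the
    point, so it is negligible.  With additivity this makes differentiability
    depend on germs only. *)
Lemma near0_differentiable (f : V -> W) (x : V) :
  (\forall y \near x, f y = 0) -> differentiable f x.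
Proof.
move=> f0; have fx0 : f x = 0 by exact: nbhs_singleton f0.
pose z : {linear V -> W} := \0.
have zc : continuous z by exact: cst_continuous.
have fz : f \o shift x = cst (f x) + z +o_ 0 id.
  apply/eqaddoE; rewrite fx0 funeqE => y /=.
  rewrite !fctE /= !add0r littleoE // => e e0.
  have /= := near_shift x 0 (fun y => f y = 0); rewrite sub0r => h.
  near=> u; suff -> : f (u + x) = 0 by rewrite normr0 mulr_ge0// ltW.
  near: u.
  by move: f0; rewrite (near_shift 0) subr0.
apply/diff_locallyP; rewrite (diff_unique zc fz); split => //.
Unshelve. all: by end_near. Qed.

Lemma near_eq_differentiable (f g : V -> W) (x : V) :
  (\forall y \near x, f y = g y) -> differentiable f x -> differentiable g x.
Proof.
move=> fg df; have -> : g = f + (g - f) by rewrite addrC subrK.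
apply: differentiableD => //; apply: near0_differentiable.
by apply: filterS fg => y fgy; rewrite !fctE fgy subrr.
Qed.

Lemma near_eq_continuous (f g : V -> W) (x : V) :
  (\forall y \near x, f y = g y) -> {for x, continuous f} ->
  {for x, continuous g}.
Proof.
move=> fg cf; rewrite /prop_for /continuous_at -(nbhs_singleton fg).
exact/(cvg_trans _ cf)/near_eq_cvg.
Qed.

End NearEq.

Section Ck.
Context {R : realType}.

Lemma Ck_on_eq {n} {W : normedModType R} k (U : set 'rV[R]_n)
    (f g : 'rV[R]_n -> W) :
  open U -> (forall x, U x -> f x = g x) -> Ck_on k U f -> Ck_on k U g.
Proof.
move=> oU; elim: k f g => [|k IH] f g fg /=.
  move=> cf x Ux; apply: near_eq_continuous (cf x Ux).
  by have := open_nbhs_nbhs (conj oU Ux); apply: filterS.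
case=> df Df; split=> [x Ux|v].
  apply: near_eq_differentiable (df x Ux).
  by have := open_nbhs_nbhs (conj oU Ux); apply: filterS.
apply: IH (Df v) => x Ux; apply: near_eq_derive.
by have := open_nbhs_nbhs (conj oU Ux); apply: filterS.
Qed.

Lemma Ck_on_sub {n} {W : normedModType R} k (U V : set 'rV[R]_n)
    (f : 'rV[R]_n -> W) : V `<=` U -> Ck_on k U f -> Ck_on k V f.
Proof.
move=> VU; elim: k f => [|k IH] f /=; first by move=> h x /VU; exact: h.
by case=> h1 h2; split=> [x /VU|v]; [exact: h1|exact: IH].
Qed.

Lemma Ck_onW {n} {W : normedModType R} k (U : set 'rV[R]_n)
    (f : 'rV[R]_n -> W) : Ck_on k.+1 U f -> Ck_on k U f.
Proof.
elim: k f => [|k IH] f; first by case=> h _ x /h /differentiable_continuous.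
by case=> h1 h2; split=> // v; exact: IH.
Qed.

Lemma Ck_on_cst {n} {W : normedModType R} k (U : set 'rV[R]_n) (c : W) :
  Ck_on k U (cst c).
Proof.
elim: k c => [|k IH] c /=; first by move=> x _; exact: cst_continuous.
split=> [x _|v]; first exact: differentiable_cst.
by rewrite (_ : 'D_v _ = cst 0)//; apply/funext => x; rewrite derive_cst.
Qed.

Lemma Ck_onD {n} {W : normedModType R} k (U : set 'rV[R]_n)
    (f g : 'rV[R]_n -> W) : open U ->
  Ck_on k U f -> Ck_on k U g -> Ck_on k U (f + g).
Proof.
move=> oU; elim: k f g => [|k IH] f g /=.
  by move=> cf cg x Ux; apply: continuousD; [exact: cf|exact: cg].
move=> [df Df] [dg Dg]; split=> [x Ux|v].
  by apply: differentiableD; [exact: df|exact: dg].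
apply: Ck_on_eq (IH _ _ (Df v) (Dg v)) => // x Ux.
by rewrite deriveD//; apply: diff_derivable; [exact: df|exact: dg].
Qed.

Lemma Ck_on_sum {n} {W : normedModType R} k (U : set 'rV[R]_n) m
    (f : 'I_m -> 'rV[R]_n -> W) : open U ->
  (forall i, Ck_on k U (f i)) -> Ck_on k U (\sum_i f i).
Proof.
move=> oU hf; apply: (big_ind (Ck_on k U)) => // [|g h].
  exact: Ck_on_cst.
exact: Ck_onD.
Qed.

(** The derivative of a product involves both factors undifferentiated, so the
    induction needs them at the lower order as well ([Ck_onW]). *)
Lemma Ck_onM {n} k (U : set 'rV[R]_n) (f g : 'rV[R]_n -> R) : open U ->
  Ck_on k U f -> Ck_on k U g -> Ck_on k U (f * g).
Proof.
move=> oU; elim: k f g => [|k IH] f g.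
  by move=> cf cg x Ux; apply: continuousM; [exact: cf|exact: cg].
move=> kf kg; case: (kf) (kg) => [df Df] [dg Dg]; split=> [x Ux|v].
  by apply: differentiableM; [exact: df|exact: dg].
apply: Ck_on_eq (Ck_onD oU (IH _ _ (Ck_onW kf) (Dg v))
  (IH _ _ (Ck_onW kg) (Df v))) => // x Ux.
by rewrite deriveM//; apply: diff_derivable; [exact: df|exact: dg].
Qed.

Lemma differentiable_comp_coord {V : normedModType R} {m} (f : V -> 'rV[R]_m)
    (a : 'I_m) x :
  differentiable f x -> differentiable (fun y => f y 0 a : R) x.
Proof.
move=> df.
exact: (@differentiable_comp _ _ _ _ f (fun N : 'rV[R]_m => N 0 a : R) x df
  (differentiable_coord _ _ _)).
Qed.

Lemma derive_coord {V : normedModType R} {m} (f : V -> 'rV[R]_m) (a : 'I_m) x v :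
  differentiable f x -> 'D_v (fun y => f y 0 a : R) x = ('D_v f x) 0 a.
Proof. by move=> df; rewrite derive_mx ?mxE//; exact: diff_derivable. Qed.

Lemma Ck_on_coord {n m} k (U : set 'rV[R]_n) (f : 'rV[R]_n -> 'rV[R]_m)
    (a : 'I_m) : open U -> Ck_on k U f -> Ck_on k U (fun x => f x 0 a : R).
Proof.
move=> oU; elim: k f => [|k IH] f.
  move=> cf x Ux; apply: (@continuous_comp _ _ _ f (fun y => y 0 a)).
    exact: cf.
  exact: coord_continuous.
case=> df Df; split=> [x Ux|v].
  exact: differentiable_comp_coord (df _ Ux).
apply: Ck_on_eq (IH _ (Df v)) => // x Ux.
by rewrite derive_coord//; exact: df.
Qed.

Lemma derive_lin {V W : normedModType R} (f : V -> W) x a u v :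
  differentiable f x -> 'D_(a *: u + v) f x = a *: 'D_u f x + 'D_v f x.
Proof. by move=> df; rewrite !deriveE// linearP. Qed.

Lemma derive_basis {m} {W : normedModType R} (f : 'rV[R]_m -> W) x v :
  differentiable f x ->
  'D_v f x = \sum_a v 0 a *: 'D_(delta_mx 0 a) f x.
Proof.
move=> df; rewrite deriveE// {1}(row_sum_delta v) linear_sum.
by apply: eq_bigr => a _; rewrite linearZ /= deriveE.
Qed.

Lemma derive_comp {V V' W : normedModType R} (f : V -> V') (g : V' -> W) x v :
  differentiable f x -> differentiable g (f x) ->
  'D_v (g \o f) x = 'D_('D_v f x) g (f x).
Proof.
move=> df dg; rewrite deriveE; last exact: differentiable_comp.
by rewrite diff_comp//= !deriveE.
Qed.

(** By the chain rule, the derivative of g o f along v is the sum of the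
    products of (D_v f)_a and (D_a g) o f; these have the same shape at a lower
    order, which is why the induction generalizes over g. *)
Lemma Ck_on_comp {n m} k (U : set 'rV[R]_n) (V : set 'rV[R]_m)
    (f : 'rV[R]_n -> 'rV[R]_m) (g : 'rV[R]_m -> R) : open U ->
  (forall x, U x -> V (f x)) ->
  Ck_on k U f -> Ck_on k V g -> Ck_on k U (g \o f).
Proof.
move=> oU UV; elim: k f UV g => [|k IH] f UV g kf kg.
  move=> x Ux; apply: continuous_comp; first exact: kf.
  exact/kg/UV.
case: (kf) (kg) => [df Df] [dg Dg]; split=> [x Ux|v].
  by apply: (@differentiable_comp _ _ _ _ f g x (df _ Ux)); exact/dg/UV.
have h : Ck_on k U (\sum_a (fun x => ('D_v f x) 0 a : R) *
                            ('D_(delta_mx 0 a) g \o f)).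
  apply: Ck_on_sum => // a; apply: Ck_onM => //; first exact: (Ck_on_coord _ oU (Df v)).
  exact: IH UV _ (Ck_onW kf) (Dg _).
apply: Ck_on_eq h => // x Ux; rewrite derive_comp; last 2 first.
- exact: df.
- exact/dg/UV.
rewrite derive_basis; last exact/dg/UV.
by rewrite fct_sumE.
Qed.

End Ck.

(** * Symmetry of second derivatives *)

Section Schwarz.
Context {R : realType}.

Section MeanValue.
Context {V : normedModType R}.

Lemma MVT_line (f : V -> R) (x u : V) (h : R) : 0 < h ->
  (forall s : R, 0 <= s <= h -> differentiable f (s *: u + x)) ->
  exists2 s, 0 <= s <= h & f (h *: u + x) - f x = h * 'D_u f (s *: u + x).
Proof.
move=> h0 df; pose l (s : R) := s *: u + x.
have dl (s : R) : is_derive s 1 l u.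
  have du : is_derive s 1 (fun t : R => t *: u) u.
    apply: DeriveDef; first exact: diff_derivable.
    by rewrite deriveE// diff_val scale1r.
  by have := is_deriveD du (is_derive_cst x s 1); rewrite addr0.
have ldiff (s : R) : differentiable l s by apply/derivable1_diffP.
have gd (s : R) : 0 <= s <= h -> is_derive s 1 (f \o l) ('D_u f (l s)).
  move=> sh; have fd := df _ sh.
  apply: DeriveDef; first by apply/diff_derivable/differentiable_comp.
  by rewrite derive_comp// derive_val.
have [] := @MVT R (f \o l) (fun s => 'D_u f (l s)) 0 h h0.
- by move=> s; rewrite in_itv/= => /andP[/ltW s0 /ltW sh]; apply: gd; rewrite s0.
- apply: derivable_within_continuous => s; rewrite in_itv/= => /gd gs.
  exact: ex_derive.
- move=> s; rewrite in_itv/= => /andP[/ltW s0 /ltW sh].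
  rewrite /= /l scale0r add0r subr0 mulrC => e.
  by exists s => //; rewrite s0.
Qed.

(** Two applications of the mean value theorem: along u to the difference
    y |-> f (y + h v) - f y, then along v to D_u f. *)
Lemma MVT_square (f : V -> R) (x u v : V) (h : R) : 0 < h ->
  (forall s t : R, 0 <= s <= h -> 0 <= t <= h ->
     differentiable f (s *: u + t *: v + x) /\
     differentiable ('D_u f) (s *: u + t *: v + x)) ->
  exists s t, [/\ 0 <= s <= h, 0 <= t <= h &
   f (h *: u + h *: v + x) - f (h *: u + x) - f (h *: v + x) + f x =
   h ^+ 2 * 'D_v ('D_u f) (s *: u + t *: v + x)].
Proof.
move=> h0 df; have h00 : 0 <= (0 : R) <= h by rewrite lexx ltW.
have hh : 0 <= h <= h by rewrite lexx ltW.
pose T (y : V) := y + h *: v.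
have dT y : is_diff y T (id : V -> V).
  have := is_diffD (is_diff_id y) (is_diff_cst (h *: v) y).
  by rewrite addr0.
have hs s : 0 <= s <= h -> differentiable f (s *: u + x).
  by move=> hs; have [] := df s 0 hs h00; rewrite scale0r addr0.
have hsT s : 0 <= s <= h -> differentiable f (T (s *: u + x)).
  by move=> hs'; have [] := df s h hs' hh; rewrite /T addrAC.
have hsT' s : 0 <= s <= h -> differentiable (f \o T) (s *: u + x).
  by move=> hs'; apply: differentiable_comp => //; exact: hsT.
have dcomp s : 0 <= s <= h ->
    'D_u (f \o T) (s *: u + x) = 'D_u f (T (s *: u + x)).
  move=> hs'; have fT := hsT s hs'.
  rewrite derive_comp; [|exact: ex_diff|exact: fT].
  by rewrite (_ : 'D_u T _ = u) // deriveE ?diff_val.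
have [s sh] := @MVT_line (f \o T - f) x u h h0 (fun s hs' =>
  differentiableB (hsT' s hs') (hs s hs')).
rewrite deriveB; [|exact/diff_derivable/hsT'|exact/diff_derivable/hs].
rewrite dcomp // => e.
have [t ht|t th] := @MVT_line ('D_u f) (s *: u + x) v h h0.
  by rewrite addrCA addrA; have [] := df s t sh ht.
rewrite [t *: v + _]addrCA addrA (addrC (h *: v) (_ + _)) => e2.
exists s, t; split; [exact: sh|exact: th|].
rewrite expr2 -mulrA -e2 -[s *: u + x + _]/(T _) -e.
rewrite !fctE /= /T.
rewrite [h *: u + x + _]addrAC [x + _]addrC opprB addrA addrAC.
by [].
Qed.

End MeanValue.

(** The second difference of f on the parallelogram with sides h u and h v is,
    by [MVT_square] applied in both orders, h^2 times a value of D_v D_u f and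
    also h^2 times a value of D_u D_v f, both at points near x.  By continuity,
    the two derivatives at x differ by at most any e > 0. *)
Theorem derive_commute {n} (U : set 'rV[R]_n) (f : 'rV[R]_n -> R) u v x :
  open U -> Ck_on 2 U f -> U x -> 'D_u ('D_v f) x = 'D_v ('D_u f) x.
Proof.
move=> oU [df Df] Ux.
have cuv : {for x, continuous ('D_u ('D_v f))} by exact: (proj2 (Df v) u x Ux).
have cvu : {for x, continuous ('D_v ('D_u f))} by exact: (proj2 (Df u) v x Ux).
apply/eqP; rewrite -subr_eq0 -normr_le0; apply/ler_addgt0Pr => e e0.
rewrite add0r; have e2 : 0 < e / 2 by rewrite divr_gt0.
have nU : \forall y \near x, U y by exact: open_nbhs_nbhs.
have : \forall y \near x, [/\ U y, `|'D_u ('D_v f) x - 'D_u ('D_v f) y| < e / 2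
   & `|'D_v ('D_u f) x - 'D_v ('D_u f) y| < e / 2].
  move/cvgrPdist_lt : cuv => /(_ _ e2) n1.
  move/cvgrPdist_lt : cvu => /(_ _ e2) n2.
  by apply: filterS3 nU n1 n2 => y Uy h1 h2; split; [exact: Uy|exact: h1|exact: h2].
move=> /nbhs_ballP[r /= r0 xr].
(* The parallelogram of size h = r / (2 K) lies in the ball of radius r; the
   summand 1 makes K positive when u and v vanish. *)
pose K := `|u| + `|v| + 1.
have K0 : 0 < K by rewrite ltr_wpDl// addr_ge0.
pose h := r / 2 / K; have h0 : 0 < h by rewrite !divr_gt0.
have inb a b s t : `|a| + `|b| + 1 = K -> 0 <= s <= h -> 0 <= t <= h ->
    ball x r (s *: a + t *: b + x).
  move=> abK /andP[s0 sh] /andP[t0 th].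
  rewrite -ball_normE /ball_/= opprD addrCA subrr addr0 normrN.
  rewrite (le_lt_trans (ler_normD _ _))// !normrZ !ger0_norm//.
  apply: (@le_lt_trans _ _ (h * K)).
    rewrite -abK !mulrDr mulr1 -[leLHS]addr0; apply: lerD; last exact: ltW.
    by apply: lerD; apply: ler_wpM2r.
  by rewrite /h divfK ?gt_eqF// ltr_pdivrMr// ltr_pMr// ltr1n.
have [|s [t [sh th e1]]] := @MVT_square _ f x u v h h0.
  move=> s t sh th; have [Uy _ _] := xr _ (inb u v s t erefl sh th).
  by split; [exact: df|exact: (proj1 (Df u))].
have vuK : `|v| + `|u| + 1 = K by rewrite /K (addrC `|u|).
have [|s' [t' [sh' th' e1']]] := @MVT_square _ f x v u h h0.
  move=> s' t' sh' th'; have [Uy _ _] := xr _ (inb v u s' t' vuK sh' th').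
  by split; [exact: df|exact: (proj1 (Df v))].
have [_ _ hb] := xr _ (inb u v s t erefl sh th).
have [_ ha _] := xr _ (inb v u s' t' vuK sh' th').
move: e1 e1' ha hb; rewrite (addrC (h *: v) (h *: u)) (addrAC (f _) (- f _)).
move: ('D_v ('D_u f) (s *: u + _ + x)) => z.
move: ('D_u ('D_v f) (s' *: v + _ + x)) => z'.
move: ('D_v ('D_u f) x) ('D_u ('D_v f) x) => c c' e1 e1'.
have -> : z' = z.
  have h2 : h ^+ 2 != 0 by rewrite expf_neq0// gt_eqF.
  have e12 : h ^+ 2 * z' = h ^+ 2 * z by rewrite -e1 -e1'.
  exact: mulfI h2 _ _ e12.
move=> h1 h2; rewrite -(subrKA z) (le_trans (ler_normD _ _))// (splitr e).
by rewrite lerD// ?ltW// distrC.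
Qed.

End Schwarz.

(** * Germs of smooth maps on R^n *)

Section SmoothNear.
Context {R : realType} {n : nat}.

Lemma smooth_near_eq {W : normedModType R} x (f g : 'rV[R]_n -> W) :
  (\forall y \near x, f y = g y) -> smooth_near x f -> smooth_near x g.
Proof.
move=> fg [U [oU Ux] sU].
have : nbhs x (U `&` [set y | f y = g y]).
  by apply: filterI => //; exact: open_nbhs_nbhs.
rewrite nbhsE => -[V [oV Vx] VU]; exists V => // k.
apply: (Ck_on_eq oV) (Ck_on_sub _ (sU k)); first by move=> y /VU[].
by move=> y /VU[].
Qed.

Lemma smooth_near_cst {W : normedModType R} x (c : W) :
  smooth_near x (cst c : 'rV[R]_n -> W).
Proof.
exists setT; first by split=> //; exact: openT.
by move=> k; exact: Ck_on_cst.
Qed.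

Lemma smooth_near_common {W W' : normedModType R} x
    (f : 'rV[R]_n -> W) (g : 'rV[R]_n -> W') :
  smooth_near x f -> smooth_near x g ->
  exists2 U, open_nbhs x U & smooth_on U f /\ smooth_on U g.
Proof.
move=> [U [oU Ux] sU] [V [oV Vx] sV]; exists (U `&` V).
  by split; [exact: openI|].
by split=> k; [apply: Ck_on_sub (sU k)|apply: Ck_on_sub (sV k)] => y [].
Qed.

Lemma smooth_nearD {W : normedModType R} x (f g : 'rV[R]_n -> W) :
  smooth_near x f -> smooth_near x g -> smooth_near x (f + g).
Proof.
move=> sf sg; have [U Ux [Uf Ug]] := smooth_near_common sf sg.
by exists U => // k; apply: Ck_onD => //; case: Ux.
Qed.

Lemma smooth_nearM x (f g : 'rV[R]_n -> R) :
  smooth_near x f -> smooth_near x g -> smooth_near x (f * g).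
Proof.
move=> sf sg; have [U Ux [Uf Ug]] := smooth_near_common sf sg.
by exists U => // k; apply: Ck_onM => //; case: Ux.
Qed.

Lemma smooth_near_derive {W : normedModType R} x v (f : 'rV[R]_n -> W) :
  smooth_near x f -> smooth_near x ('D_v f).
Proof. by move=> [U Ux sU]; exists U => // k; have [_ Df] := sU k.+1; exact: Df. Qed.

Lemma smooth_near_differentiable {W : normedModType R} x (f : 'rV[R]_n -> W) :
  smooth_near x f -> differentiable f x.
Proof. by move=> [U [_ Ux] sU]; have [df _] := sU 1%N; exact: df. Qed.

Lemma smooth_near_join {W : normedModType R} x (f : 'rV[R]_n -> W) :
  smooth_near x f -> \forall y \near x, smooth_near y f.
Proof.
move=> [U Ux sU]; have := open_nbhs_nbhs Ux; apply: filterS => y Uy.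
by exists U => //; case: Ux.
Qed.

Lemma smooth_near_continuous {W : normedModType R} x (f : 'rV[R]_n -> W) :
  smooth_near x f -> {for x, continuous f}.
Proof. by move/smooth_near_differentiable/differentiable_continuous. Qed.

Lemma smooth_near_coord {m} x (f : 'rV[R]_n -> 'rV[R]_m) (a : 'I_m) :
  smooth_near x f -> smooth_near x (fun y => f y 0 a : R).
Proof.
move=> [U Ux sU]; exists U => // k; apply: Ck_on_coord => //; by case: Ux.
Qed.

Lemma smooth_near_comp {m} x (f : 'rV[R]_n -> 'rV[R]_m) (g : 'rV[R]_m -> R) :
  smooth_near x f -> smooth_near (f x) g -> smooth_near x (g \o f).
Proof.
move=> sf [V Vfx sV]; have [U Ux sU] := sf.
have : nbhs x (U `&` f @^-1` V).
  apply: filterI; first exact: open_nbhs_nbhs.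
  exact/(smooth_near_continuous sf)/open_nbhs_nbhs.
rewrite nbhsE => -[B [oB Bx] BU]; exists B => // k.
apply: Ck_on_comp (sV k) => //; first by move=> y /BU[].
by apply: Ck_on_sub (sU k) => y /BU[].
Qed.

Lemma smooth_near_id (x : 'rV[R]_n) : smooth_near x id.
Proof.
exists setT; first by split=> //; exact: openT.
case=> [y _|k]; first exact: cvg_id.
split=> [y _ //|v]; rewrite (_ : 'D_v id = cst v); first exact: Ck_on_cst.
by apply/funext => y; rewrite derive_id.
Qed.

End SmoothNear.

(** * Functions, vectors and brackets in charts *)

Local Notation "'phi' p" := (cmap (chart_at p)) (at level 10, p at level 8).
Local Notation "'psi' p" := (cinv (chart_at p)) (at level 10, p at level 8).
Local Notation "'src' p" := (csrc (chart_at p)) (at level 10, p at level 8).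

Section Charts.
Context {R : realType} {n : nat} {M : manifold R n}.
Implicit Types (p q r : M) (x y : 'rV[R]_n).

Lemma near_src p q : src p q -> \forall r \near q, src p r.
Proof. by move=> pq; apply: open_nbhs_nbhs; split=> //; exact: csrc_open. Qed.

Lemma near_cinv p q (P : M -> Prop) : src p q ->
  (\forall r \near q, P r) -> \forall x \near phi p q, P (psi p x).
Proof.
move=> pq nP; have /= := @cinv_cont _ _ _ (chart_at p) (phi p q).
by move=> /(_ (imageP _ pq)); apply; rewrite /= cmapK.
Qed.

Lemma near_cmap p q (P : 'rV[R]_n -> Prop) : src p q ->
  (\forall x \near phi p q, P x) -> \forall r \near q, P (phi p r).
Proof. by move=> pq nP; exact: (@cmap_cont _ _ _ (chart_at p) q pq). Qed.

Lemma near_cinvK p q : src p q ->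
  \forall x \near phi p q, src p (psi p x) /\ phi p (psi p x) = x.
Proof.
move=> pq; have : nbhs (phi p q) (phi p @` src p).
  by apply: open_nbhs_nbhs; split; [exact: cimg_open|exact: imageP].
by apply: filterS => _ [r pr <-]; rewrite cmapK.
Qed.

Lemma smooth_transition p q r : src p r -> src q r ->
  smooth_near (phi p r) (phi q \o psi p).
Proof.
move=> pr qr.
have : nbhs (phi p r) (phi p @` (src p `&` src q)).
  apply: filterS2 (near_cinvK pr) (near_cinv pr (near_src qr)).
  by move=> x [px e] qx; exists (psi p x).
rewrite nbhsE => -[B [oB Bx] BU]; exists B => // k.
exact: Ck_on_sub BU (chart_compat p q k).
Qed.

(** The two local expressions of f differ by a transition map, which is
    smooth. *)
Lemma smooth_near_chart p q r (f : M -> R) : src p r -> src q r ->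
  smooth_near (phi p r) (f \o psi p) -> smooth_near (phi q r) (f \o psi q).
Proof.
move=> pr qr sf; have := smooth_near_comp (smooth_transition qr pr).
rewrite /= cmapK// => /(_ _ sf); apply: smooth_near_eq.
by apply: filterS (near_cinv qr (near_src pr)) => x px /=; rewrite cmapK.
Qed.

Lemma smooth_atP p q (f : M -> R) : src p q ->
  smooth_at q f <-> smooth_near (phi p q) (f \o psi p).
Proof.
by move=> pq; have qq := chart_at_src q; split; exact: smooth_near_chart.
Qed.

Lemma smooth_at_near p (f : M -> R) : smooth_at p f ->
  \forall q \near p, smooth_at q f.
Proof.
have pp := chart_at_src p.
move=> /smooth_near_join /(near_cmap pp) h.
by apply: filterS2 h (near_src pp) => q sf pq; apply/(smooth_atP _ pq).
Qed.

Lemma smooth_at_eq {W : normedModType R} p (f g : M -> W) :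
  (\forall q \near p, f q = g q) -> smooth_at p f -> smooth_at p g.
Proof.
by move=> fg; apply: smooth_near_eq; apply: near_cinv fg; exact: chart_at_src.
Qed.

Lemma smooth_at_cst {W : normedModType R} p (c : W) : smooth_at p (cst c : M -> W).
Proof. exact: smooth_near_cst. Qed.

Lemma smooth_atD {W : normedModType R} p (f g : M -> W) :
  smooth_at p f -> smooth_at p g -> smooth_at p (f + g).
Proof. exact: smooth_nearD. Qed.

Lemma smooth_atM p (f g : M -> R) :
  smooth_at p f -> smooth_at p g -> smooth_at p (f * g).
Proof. exact: smooth_nearM. Qed.

Lemma smooth_at_sum {W : normedModType R} p m (f : 'I_m -> M -> W) :
  (forall i, smooth_at p (f i)) -> smooth_at p (fun q => \sum_i f i q).
Proof.
move=> sf; rewrite (_ : (fun _ => _) = \sum_i f i); last first.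
  by apply/funext => q; rewrite fct_sumE.
apply: big_ind => //; first exact: smooth_at_cst.
by move=> g h; exact: smooth_atD.
Qed.

Lemma smooth_at_chart p q (g : 'rV[R]_n -> R) : src p q ->
  smooth_near (phi p q) g -> smooth_at q (g \o phi p).
Proof.
move=> pq sg; apply/(smooth_atP _ pq); apply: smooth_near_eq sg.
by apply: filterS (near_cinvK pq) => x [_ /= ->].
Qed.

Lemma smooth_at_coord p q (a : 'I_n) : src p q ->
  smooth_at q (fun r => phi p r 0 a : R).
Proof.
move=> pq.
exact: (smooth_at_chart pq (smooth_near_coord a (smooth_near_id (phi p q)))).
Qed.

Lemma smooth_at_diff p (f : M -> R) : smooth_at p f ->
  differentiable (f \o psi p) (Defs.coord p).
Proof. exact: smooth_near_differentiable. Qed.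

Lemma dir_near_eq p x (f g : M -> R) :
  (\forall q \near p, f q = g q) -> dir p x f = dir p x g.
Proof.
move=> fg; apply: near_eq_derive.
exact: near_cinv (chart_at_src p) fg.
Qed.

Lemma dir_cst p x (c : R) : dir p x (cst c) = 0.
Proof. by rewrite /dir (_ : _ \o _ = cst c)// derive_cst. Qed.

Lemma dir_linear p a x y (f : M -> R) : smooth_at p f ->
  dir p (a *: x + y) f = a * dir p x f + dir p y f.
Proof. by move=> /smooth_at_diff sf; rewrite /dir derive_lin. Qed.

Lemma dirD p x (f g : M -> R) : smooth_at p f -> smooth_at p g ->
  dir p x (fun q => f q + g q) = dir p x f + dir p x g.
Proof.
move=> /smooth_at_diff sf /smooth_at_diff sg.
by rewrite -deriveD//; exact: diff_derivable.
Qed.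

Lemma dirM p x (f g : M -> R) : smooth_at p f -> smooth_at p g ->
  dir p x (fun q => f q * g q) = dir p x f * g p + f p * dir p x g.
Proof.
move=> /smooth_at_diff sf /smooth_at_diff sg; have pp := chart_at_src p.
rewrite /dir (_ : (fun _ => _) \o _ = (f \o psi p) * (g \o psi p))//.
rewrite deriveM; last 2 first.
- exact: diff_derivable.
- exact: diff_derivable.
by rewrite /= /Defs.coord (cmapK pp) addrC [_ *: _]mulrC.
Qed.

Lemma dir_sum p x m (f : 'I_m -> M -> R) : (forall i, smooth_at p (f i)) ->
  dir p x (fun q => \sum_i f i q) = \sum_i dir p x (f i).
Proof.
move=> sf; rewrite /dir.
rewrite (_ : (fun _ => _) \o _ = \sum_i (f i \o psi p)); last first.
  by apply/funext => q; rewrite fct_sumE.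
by rewrite derive_sum// => i; exact/diff_derivable/smooth_at_diff.
Qed.

(** The components, in the chart at p, of the vector of T_qM whose components
    in the chart at q are y; inverse to [ext p ^~ q]. *)
Definition chart_vec p q y : 'rV[R]_n := 'D_y (phi p \o psi q) (Defs.coord q).

Lemma chart_vecE p q y a : src p q ->
  chart_vec p q y 0 a = dir q y (fun r => phi p r 0 a).
Proof.
move=> pq; rewrite -derive_coord//.
exact/smooth_near_differentiable/smooth_transition/pq/chart_at_src.
Qed.

Lemma chart_vec_id p y : chart_vec p p y = y.
Proof.
rewrite /chart_vec -[RHS](derive_id (Defs.coord p)); apply: near_eq_derive.
by apply: filterS (near_cinvK (chart_at_src p)) => x [_].
Qed.

Lemma transition_diff p q r : src p r -> src q r ->
  differentiable (phi q \o psi p) (phi p r).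
Proof. by move=> pr qr; exact/smooth_near_differentiable/smooth_transition. Qed.

Lemma dir_chart p q y (f : M -> R) : src p q -> smooth_at q f ->
  dir q y f = 'D_(chart_vec p q y) (f \o psi p) (phi p q).
Proof.
move=> pq sf; have qq := chart_at_src q.
have := derive_comp y (transition_diff qq pq); rewrite /= (cmapK qq) => <-.
- apply: near_eq_derive.
  by apply: filterS (near_cinv qq (near_src pq)) => x px /=; rewrite cmapK.
- exact/smooth_near_differentiable/smooth_atP.
Qed.

Lemma transition_derive p q r s x : src p s -> src q s -> src r s ->
  'D_('D_x (phi q \o psi p) (phi p s)) (phi r \o psi q) (phi q s) =
  'D_x (phi r \o psi p) (phi p s).
Proof.
move=> ps qs rs.
have := derive_comp x (transition_diff ps qs); rewrite /= (cmapK ps) => <-.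
- apply: near_eq_derive.
  by apply: filterS (near_cinv ps (near_src qs)) => y px /=; rewrite cmapK.
- exact: transition_diff.
Qed.

Lemma transition_id p q x : src p q -> 'D_x (phi p \o psi p) (phi p q) = x.
Proof.
move=> pq; rewrite -[RHS](derive_id (phi p q)); apply: near_eq_derive.
by apply: filterS (near_cinvK pq) => y [_].
Qed.

Lemma chart_vecK p q y : src p q -> ext p (chart_vec p q y) q = y.
Proof.
move=> pq; have qq := chart_at_src q.
by rewrite /ext /chart_vec /Defs.coord transition_derive// transition_id.
Qed.

Lemma extK p q x : src p q -> chart_vec p q (ext p x q) = x.
Proof.
move=> pq; have qq := chart_at_src q.
by rewrite /ext /chart_vec /Defs.coord transition_derive// transition_id.
Qed.

Lemma ext_id p x : ext p x p = x.
Proof. by rewrite -[RHS](transition_id _ (chart_at_src p)). Qed.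

Lemma ext_linear p q a x y : src p q ->
  ext p (a *: x + y) q = a *: ext p x q + ext p y q.
Proof.
move=> pq; rewrite /ext derive_lin//.
by apply: transition_diff => //; exact: chart_at_src.
Qed.

(** In the chart at p the field [ext p x] is constant, so it acts as a
    directional derivative. *)
Lemma dir_ext p q x (f : M -> R) : src p q -> smooth_at q f ->
  dir q (ext p x q) f = 'D_x (f \o psi p) (phi p q).
Proof. by move=> pq sf; rewrite (dir_chart _ pq sf) (extK _ pq). Qed.

Lemma smooth_ext p q x : src p q -> smooth_vf q (ext p x).
Proof.
move=> pq f sf.
have sg : smooth_near (phi p q) ('D_x (f \o psi p)).
  by apply: smooth_near_derive; apply/smooth_atP.
apply: smooth_at_eq (smooth_at_chart pq sg).
by apply: filterS2 (near_src pq) (smooth_at_near sf) => r pr fr; rewrite dir_ext.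
Qed.

(** Differentiating Y f = sum_a Y^a d_a f along x gives a first-order term, with
    coefficients the x(Y^a), and a second-order term, which the symmetry of
    second derivatives lets one write as the derivative along Y p of the
    derivative of f along x. *)
Lemma dir_dir p x (Y : M -> 'rV[R]_n) (f : M -> R) :
  smooth_vf p Y -> smooth_at p f ->
  dir p x (fun q => dir q (Y q) f) =
  dir p (\row_a dir p x (fun q => dir q (Y q) (fun r => phi p r 0 a))) f
  + 'D_(Y p) ('D_x (f \o psi p)) (Defs.coord p).
Proof.
move=> sY sf; have pp := chart_at_src p.
pose d a := 'D_(delta_mx 0 a) (f \o psi p) : 'rV[R]_n -> R.
have sd a : smooth_near (Defs.coord p) (d a) by exact: smooth_near_derive.
have sY' a : smooth_at p (fun q => dir q (Y q) (fun r => phi p r 0 a)).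
  by apply: sY; exact: smooth_at_coord.
rewrite (@dir_near_eq _ _ _ (fun q => \sum_a
  dir q (Y q) (fun r => phi p r 0 a) * (d a \o phi p) q)); last first.
  apply: filterS2 (near_src pp) (smooth_at_near sf) => q pq fq.
  rewrite (dir_chart _ pq)// derive_basis; last first.
    exact/smooth_near_differentiable/smooth_atP.
  by apply: eq_bigr => a _; rewrite -chart_vecE.
rewrite dir_sum; last first.
  by move=> a; apply: smooth_atM => //; exact: smooth_at_chart (sd a).
under eq_bigr => a _.
  rewrite dirM//; last exact: smooth_at_chart (sd a).
  over.
rewrite big_split /=; congr (_ + _).
  rewrite /dir [RHS]derive_basis; last exact: smooth_at_diff.
  by apply: eq_bigr => a _; rewrite mxE.
rewrite derive_basis; last first.
  exact/smooth_near_differentiable/smooth_near_derive.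
apply: eq_bigr => a _.
have -> : dir p (Y p) (fun r => phi p r 0 a) = Y p 0 a.
  by rewrite -(chart_vecE _ _ pp) chart_vec_id.
have [U [oU Ux] sU] := sf.
rewrite -(derive_commute x (delta_mx 0 a) oU (sU 2%N) Ux).
have -> : dir p x (d a \o phi p) = 'D_x (d a) (Defs.coord p); last by [].
apply: near_eq_derive.
by apply: filterS (near_cinvK pp) => y [_ /= ->].
Qed.

(** The bracket is defined by its action on the coordinate functions; on a
    general function the second-order terms of X (Y f) and Y (X f) cancel by the
    symmetry of second derivatives. *)
Lemma dir_bracket p (X Y : M -> 'rV[R]_n) (f : M -> R) :
  smooth_vf p X -> smooth_vf p Y -> smooth_at p f ->
  dir p (bracket X Y p) f =
  dir p (X p) (fun q => dir q (Y q) f) - dir p (Y p) (fun q => dir q (X q) f).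
Proof.
move=> sX sY sf.
have rowB (u w : 'I_n -> R) :
    \row_a (u a - w a) = (-1) *: \row_a w a + \row_a u a.
  by apply/rowP => a; rewrite !mxE mulN1r addrC.
rewrite /bracket rowB.
rewrite (dir_linear _ _ _ sf) (dir_dir _ sY sf) (dir_dir _ sX sf).
have [U [oU Ux] sU] := sf.
rewrite (derive_commute (X p) (Y p) oU (sU 2%N) Ux).
have alg (c d d' : R) : -1 * d + d' = d' + c - (d + c) by ring.
exact: alg.
Qed.

Lemma bracket_ext p x y : bracket (ext p x) (ext p y) p = 0.
Proof.
have pp := chart_at_src p.
have h (z w : 'rV[R]_n) a :
    dir p w (fun q => dir q (ext p z q) (fun r => phi p r 0 a)) = 0.
  rewrite (@dir_near_eq _ _ _ (cst (z 0 a))) ?dir_cst//.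
  by apply: filterS (near_src pp) => q pq; rewrite -chart_vecE// extK.
have rowB0 (u w : 'I_n -> R) : (forall a, u a = 0) -> (forall a, w a = 0) ->
    \row_a (u a - w a) = 0.
  by move=> u0 w0; apply/rowP => a; rewrite !mxE u0 w0 subrr.
by apply: rowB0 => a; exact: h.
Qed.

End Charts.

(** * Linear maps given by their linearity equation *)

Section LinearMaps.
Context {R : pzRingType} {U V : lmodType R} (L : U -> V).
Hypothesis linL : forall a x y, L (a *: x + y) = a *: L x + L y.

Lemma lin0 : L 0 = 0.
Proof. by have := linL (-1) 0 0; rewrite scaler0 addr0 scaleN1r addNr. Qed.

Lemma linZ a x : L (a *: x) = a *: L x.
Proof. by rewrite -[a *: x]addr0 linL lin0 addr0. Qed.

Lemma linD x y : L (x + y) = L x + L y.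
Proof. by rewrite -[x]scale1r linL !scale1r. Qed.

Lemma linN x : L (- x) = - L x.
Proof. by rewrite -scaleN1r linZ scaleN1r. Qed.

Lemma linB x y : L (x - y) = L x - L y.
Proof. by rewrite linD linN. Qed.

Lemma lin_sum m (x : 'I_m -> U) : L (\sum_i x i) = \sum_i L (x i).
Proof. by apply: big_morph; [exact: linD|exact: lin0]. Qed.

Lemma lin_comb m (c : 'I_m -> R) (x : 'I_m -> U) :
  L (\sum_i c i *: x i) = \sum_i c i *: L (x i).
Proof. by rewrite lin_sum; apply: eq_bigr => i _; rewrite linZ. Qed.

End LinearMaps.

(** Stated for a bare function with its linearity equation, since
    connections, differentials and curvatures come with such equations and not
    as bundled linear maps. *)
Lemma lin_basis {R : pzRingType} {m} {V : lmodType R} (L : 'rV[R]_m -> V)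
    (linL : forall a x y, L (a *: x + y) = a *: L x + L y) y :
  L y = \sum_b y 0 b *: L (delta_mx 0 b).
Proof. by rewrite {1}(row_sum_delta y) lin_comb. Qed.

Lemma lincombB {R : pzRingType} {V : lmodType R} (a : R) (u u' w w' : V) :
  a *: u + u' - (a *: w + w') = a *: (u - w) + (u' - w').
Proof. by rewrite scalerBr opprD addrACA. Qed.

(** * Vector fields along a smooth map *)

Section Along.
Context {R : realType} {m n : nat} {M : manifold R m} {N : manifold R n}.
Variables (F : M -> N) (sF : smooth_map F).
Implicit Types (p q : M) (Y Z : M -> 'rV[R]_n).

Lemma near_along_map p (P : N -> Prop) :
  (\forall r \near F p, P r) -> \forall q \near p, P (F q).
Proof. by move=> nP; exact: ((sF p).1 _ nP). Qed.

Lemma near_along_map_src p : \forall q \near p, src (F p) (F q).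
Proof. by apply: near_along_map; apply: near_src; exact: chart_at_src. Qed.

Let dF p := smooth_near_differentiable (sF p).2.

Let Fcoord p : (cmap (chart_at (F p)) \o F \o cinv (chart_at p)) (Defs.coord p)
  = Defs.coord (F p).
Proof. by rewrite /= /Defs.coord cmapK//; exact: chart_at_src. Qed.

Let Fnear p (f : N -> R) : \forall x \near Defs.coord p,
  ((f \o psi (F p)) \o (phi (F p) \o F \o psi p)) x = ((f \o F) \o psi p) x.
Proof.
have := near_cinv (chart_at_src p) (near_along_map_src p).
by apply: filterS => x Fx /=; rewrite cmapK.
Qed.

Lemma smooth_at_comp p (f : N -> R) : smooth_at (F p) f -> smooth_at p (f \o F).
Proof.
move=> sf; apply: smooth_near_eq (Fnear p f) _.
by apply: smooth_near_comp; [exact: (sF p).2|rewrite Fcoord].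
Qed.

Lemma dmap_linear p a x y :
  dmap F p (a *: x + y) = a *: dmap F p x + dmap F p y.
Proof. exact: derive_lin (dF p). Qed.

Lemma dir_comp p x (f : N -> R) : smooth_at (F p) f ->
  dir p x (f \o F) = dir (F p) (dmap F p x) f.
Proof.
move=> sf; rewrite /dir -(near_eq_derive _ (Fnear p f)).
rewrite derive_comp; last 2 first.
- exact: dF.
- by rewrite Fcoord; exact: smooth_near_differentiable sf.
by rewrite Fcoord.
Qed.

(** For fixed p, the functions [along_coord p Y a] are the components of Y near
    p in the one chart at F p, whereas those of [Y q] itself refer to the chart
    at F q. *)
Definition along_coord p Y (a : 'I_n) : M -> R :=
  fun q => chart_vec (F p) (F q) (Y q) 0 a.

Lemma along_coord_id p Y a : along_coord p Y a p = Y p 0 a.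
Proof. by rewrite /along_coord chart_vec_id. Qed.

Lemma smooth_along_coord p Y a : smooth_along F p Y ->
  smooth_at p (along_coord p Y a).
Proof.
move=> sY; apply: smooth_at_eq (sY _ (smooth_at_coord a (chart_at_src (F p)))).
by apply: filterS (near_along_map_src p) => q Fq; rewrite -chart_vecE.
Qed.

Lemma along_expand p Y : \forall q \near p,
  Y q = \sum_a along_coord p Y a q *: ext (F p) (delta_mx 0 a) (F q).
Proof.
apply: filterS (near_along_map_src p) => q Fq.
rewrite -(lin_basis (L := fun x => ext (F p) x (F q))) ?chart_vecK//.
by move=> a x y; exact: ext_linear.
Qed.

Lemma smooth_along_eq p Y Z : (\forall q \near p, Y q = Z q) ->
  smooth_along F p Y -> smooth_along F p Z.
Proof.
move=> YZ sY f sf; apply: smooth_at_eq (sY f sf).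
by apply: filterS YZ => q ->.
Qed.

Lemma smooth_along_lincomb p (f : M -> R) Y Z : smooth_at p f ->
  smooth_along F p Y -> smooth_along F p Z ->
  smooth_along F p (fun q => f q *: Y q + Z q).
Proof.
move=> sf sY sZ g sg.
apply: (@smooth_at_eq _ _ _ _ _
  (f * (fun q => dir (F q) (Y q) g) + (fun q => dir (F q) (Z q) g))).
  apply: filterS (near_along_map (smooth_at_near sg)) => q sgq.
  by rewrite dir_linear.
by apply: smooth_atD; [apply: smooth_atM => //; exact: sY|exact: sZ].
Qed.

Lemma smooth_along0 (p : M) : smooth_along F p (fun=> 0).
Proof.
move=> f sf; apply: (@smooth_at_eq _ _ _ _ _ (cst 0)).
  by apply: nearW => q; rewrite /dir derive0.
exact: smooth_at_cst.
Qed.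

Arguments smooth_along0 : clear implicits.

Lemma smooth_alongZ p (f : M -> R) Y : smooth_at p f ->
  smooth_along F p Y -> smooth_along F p (fun q => f q *: Y q).
Proof.
move=> sf sY; have := smooth_along_lincomb sf sY (smooth_along0 p).
by apply: smooth_along_eq; apply: nearW => q; rewrite addr0.
Qed.

Lemma smooth_alongD p Y Z : smooth_along F p Y -> smooth_along F p Z ->
  smooth_along F p (fun q => Y q + Z q).
Proof.
move=> sY sZ.
have := smooth_along_lincomb (smooth_at_cst p (1 : R)) sY sZ.
by apply: smooth_along_eq; apply: nearW => q; rewrite scale1r.
Qed.

Lemma smooth_alongN p Y : smooth_along F p Y -> smooth_along F p (fun q => - Y q).
Proof.
move=> sY.
have := smooth_alongZ (smooth_at_cst p (-1 : R)) sY.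
by apply: smooth_along_eq; apply: nearW => q; rewrite scaleN1r.
Qed.

Lemma smooth_alongB p Y Z : smooth_along F p Y -> smooth_along F p Z ->
  smooth_along F p (fun q => Y q - Z q).
Proof. by move=> sY sZ; exact: (smooth_alongD sY (smooth_alongN sZ)). Qed.

Lemma smooth_along_sum p k (Y : 'I_k -> M -> 'rV[R]_n) :
  (forall i, smooth_along F p (Y i)) ->
  smooth_along F p (fun q => \sum_i Y i q).
Proof.
move=> sY; rewrite (_ : (fun _ => _) = \sum_i Y i); last first.
  by apply/funext => q; rewrite fct_sumE.
apply: (big_ind (smooth_along F p)) => [|g h|i _]; last exact: sY.
  exact: smooth_along0.
exact: smooth_alongD.
Qed.

Lemma smooth_along_restrict p (Z : N -> 'rV[R]_n) :
  smooth_vf (F p) Z -> smooth_along F p (Z \o F).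
Proof. by move=> sZ f /sZ; exact: smooth_at_comp. Qed.

Lemma smooth_along_push p X : smooth_vf p X -> smooth_along F p (push F X).
Proof.
move=> sX f sf; apply: smooth_at_eq (sX _ (smooth_at_comp sf)).
apply: filterS (near_along_map (smooth_at_near sf)) => q sfq.
by rewrite /push dir_comp.
Qed.

(** Near p, Y is a combination of the fields d_a o F with the smooth
    coefficients [along_coord p Y a]; both are smooth at nearby points. *)
Lemma smooth_along_near p Y : smooth_along F p Y ->
  \forall q \near p, smooth_along F q Y.
Proof.
move=> sY.
have sc : \forall q \near p, forall a, smooth_at q (along_coord p Y a).
  apply: filter_forall => a.
  exact: smooth_at_near (smooth_along_coord a sY).
apply: filterS3 sc (near_along_map_src p) (near_join (along_expand p Y)) => q sq Fq Yq.
apply: (@smooth_along_eq q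
   (fun q => \sum_a along_coord p Y a q *: ext (F p) (delta_mx 0 a) (F q))).
  by apply: filterS Yq => r <-.
apply: smooth_along_sum => a; apply: smooth_alongZ => //.
exact: smooth_along_restrict (smooth_ext _ Fq).
Qed.

(** A property of germs of fields along F that is preserved by sums and by
    products with smooth functions holds for all fields once it holds for the
    coordinate fields d_a o F, by [along_expand]. *)
Lemma smooth_along_ind p (P : (M -> 'rV[R]_n) -> Prop) :
  (forall Y Z, smooth_along F p Y -> (\forall q \near p, Y q = Z q) ->
     P Y -> P Z) ->
  (forall Y Z, smooth_along F p Y -> smooth_along F p Z -> P Y -> P Z ->
     P (fun q => Y q + Z q)) ->
  (forall (f : M -> R) Y, smooth_at p f -> smooth_along F p Y -> P Y ->
     P (fun q => f q *: Y q)) ->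
  (forall e, P (ext (F p) e \o F)) ->
  forall Y, smooth_along F p Y -> P Y.
Proof.
move=> Peq PD PZ Pext Y sY.
have sext e : smooth_along F p (ext (F p) e \o F).
  by apply: smooth_along_restrict; apply: smooth_ext; exact: chart_at_src.
pose T a := fun q => along_coord p Y a q *: ext (F p) (delta_mx 0 a) (F q).
have sT a : smooth_along F p (T a).
  exact: smooth_alongZ (smooth_along_coord a sY) (sext _).
have [sS PS] : smooth_along F p (\sum_a T a) /\ P (\sum_a T a).
  apply: (big_ind (fun Z => smooth_along F p Z /\ P Z)).
  - split; first exact: smooth_along0.
    apply: (Peq (fun q => (0 : R) *: (ext (F p) 0 \o F) q)).
    + exact: (smooth_alongZ (smooth_at_cst p (0 : R)) (sext 0)).
    + by apply: nearW => q; rewrite scale0r.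
    + exact: (PZ _ _ (smooth_at_cst p (0 : R)) (sext 0) (Pext 0)).
  - by move=> g h [sg Pg] [sh Ph]; split; [exact: smooth_alongD|exact: PD].
  - move=> a _; split; first exact: sT.
    exact: (PZ _ _ (smooth_along_coord a sY) (sext _) (Pext _)).
apply: Peq sS _ PS; apply: filterS (along_expand p Y) => q ->.
by rewrite fct_sumE.
Qed.

End Along.
Arguments smooth_along0 {R m n M N} F p.

Lemma smooth_map_id {R : realType} {n} {M : manifold R n} :
  smooth_map (fun p : M => p).
Proof.
move=> p; split; first exact: cvg_id.
by apply: smooth_transition; exact: chart_at_src.
Qed.

(** * Riemannian metrics *)

Section Metric.
Context {R : realType} {m n : nat} {M : manifold R m} {N : manifold R n}.
Variables (F : M -> N) (sF : smooth_map F).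
Variables (g : N -> 'rV[R]_n -> 'rV[R]_n -> R) (hg : riemannian_metric g).

Lemma metric_linearr p a x y z : g p z (a *: x + y) = a * g p z x + g p z y.
Proof. by rewrite !(Defs.metric_sym hg p z) metric_linear. Qed.

Lemma metricDl p x y z : g p (x + y) z = g p x z + g p y z.
Proof. exact: (@linD R _ R^o (g p ^~ z) (fun a x y => metric_linear hg p a x y z)). Qed.

Lemma metricDr p x y z : g p z (x + y) = g p z x + g p z y.
Proof. exact: (@linD R _ R^o (g p z) (fun a x y => metric_linearr p a x y z)). Qed.

Lemma metricBl p x y z : g p (x - y) z = g p x z - g p y z.
Proof. exact: (@linB R _ R^o (g p ^~ z) (fun a x y => metric_linear hg p a x y z)). Qed.

Lemma metricBr p x y z : g p z (x - y) = g p z x - g p z y.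
Proof. exact: (@linB R _ R^o (g p z) (fun a x y => metric_linearr p a x y z)). Qed.

Lemma metricZl p a x z : g p (a *: x) z = a * g p x z.
Proof. exact: (@linZ R _ R^o (g p ^~ z) (fun a x y => metric_linear hg p a x y z)). Qed.

Lemma metricZr p a x z : g p z (a *: x) = a * g p z x.
Proof. exact: (@linZ R _ R^o (g p z) (fun a x y => metric_linearr p a x y z)). Qed.

Lemma metric_suml p k (x : 'I_k -> 'rV[R]_n) z :
  g p (\sum_i x i) z = \sum_i g p (x i) z.
Proof. exact: (@lin_sum R _ R^o (g p ^~ z) (fun a x y => metric_linear hg p a x y z)). Qed.

Lemma metric_sumr p k (x : 'I_k -> 'rV[R]_n) z :
  g p z (\sum_i x i) = \sum_i g p z (x i).
Proof. exact: (@lin_sum R _ R^o (g p z) (fun a x y => metric_linearr p a x y z)). Qed.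

Lemma smooth_metric_along p Y Z : smooth_along F p Y -> smooth_along F p Z ->
  smooth_at p (fun q => g (F q) (Y q) (Z q)).
Proof.
move=> sY sZ; move: Y sY.
apply: smooth_along_ind => //.
- move=> Y Y' _ YY' h; apply: smooth_at_eq h.
  by apply: filterS YY' => q ->.
- move=> Y Y' _ _ h h'; apply: smooth_at_eq (smooth_atD h h').
  by apply: nearW => q; rewrite metricDl.
- move=> f Y sf _ h; apply: smooth_at_eq (smooth_atM sf h).
  by apply: nearW => q; rewrite metricZl.
move=> e; move: Z sZ; apply: smooth_along_ind => //.
- move=> Y Y' _ YY' h; apply: smooth_at_eq h.
  by apply: filterS YY' => q ->.
- move=> Y Y' _ _ h h'; apply: smooth_at_eq (smooth_atD h h').
  by apply: nearW => q; rewrite metricDr.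
- move=> f Y sf _ h; apply: smooth_at_eq (smooth_atM sf h).
  by apply: nearW => q; rewrite metricZr.
move=> e'.
have FF := chart_at_src (F p).
exact: (smooth_at_comp sF (metric_smooth hg (smooth_ext e FF) (smooth_ext e' FF))).
Qed.

End Metric.

(** * Connections along a map *)

Section Connection.
Context {R : realType} {m n : nat} {M : manifold R m} {N : manifold R n}.
Variables (F : M -> N) (sF : smooth_map F).
Variables (D : M -> 'rV[R]_m -> (M -> 'rV[R]_n) -> 'rV[R]_n).
Hypothesis cD : connection_along F D.
Implicit Types (p q : M) (Y Z : M -> 'rV[R]_n).

(** A connection depends on germs only: multiply both fields by the indicator
    function of the set where they agree, which is constant near p, and apply
    the Leibniz rule. *)
Lemma conn_eq p x Y Z : smooth_along F p Y -> (\forall q \near p, Y q = Z q) ->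
  D p x Y = D p x Z.
Proof.
move=> sY YZ; have sZ := smooth_along_eq YZ sY.
pose f : M -> R := \1_[set q | Y q = Z q].
have fE q : Y q = Z q -> f q = 1 by move=> e; rewrite /f indicE mem_set.
have sf : smooth_at p f.
  apply: smooth_at_eq (smooth_at_cst p (1 : R)).
  by apply: filterS YZ => q /fE ->.
have df : dir p x f = 0.
  by rewrite -(dir_cst p x 1); apply: dir_near_eq; apply: filterS YZ => q /fE.
have h W : smooth_along F p W -> D p x (fun q => f q *: W q) = D p x W.
  move=> sW; rewrite (connection_leibniz cD _ sf sW) df scale0r add0r.
  by rewrite fE ?scale1r//; exact: nbhs_singleton YZ.
rewrite -h// -(h Z)//; congr (D p x _); apply/funext => q.
have [YZq|YZq] := pselect (Y q = Z q); first by rewrite YZq.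
by rewrite /f indicE memNset// !scale0r.
Qed.

Lemma conn_eq_near p Y Z : smooth_along F p Y -> (\forall q \near p, Y q = Z q) ->
  \forall q \near p, forall x, D q x Y = D q x Z.
Proof.
move=> sY YZ.
apply: filterS2 (smooth_along_near sF sY) (near_join YZ) => q sYq YZq x.
exact: conn_eq.
Qed.

Lemma conn0 p x : D p x (fun=> 0) = 0.
Proof.
have e : D p x (fun q => cst (0 : R) q *: (0 : 'rV[R]_n)) = 0.
  rewrite (connection_leibniz cD x (smooth_at_cst p (0 : R)) (smooth_along0 F p)).
  by rewrite dir_cst !scale0r addr0.
by rewrite -[RHS]e; congr (D p x _); apply/funext => q; rewrite scaler0.
Qed.

Lemma conn_sum p x k (Y : 'I_k -> M -> 'rV[R]_n) :
  (forall i, smooth_along F p (Y i)) ->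
  D p x (fun q => \sum_i Y i q) = \sum_i D p x (Y i).
Proof.
move=> sY; suff [] : smooth_along F p (fun q => \sum_i Y i q) /\
    D p x (fun q => \sum_i Y i q) = \sum_i D p x (Y i) by [].
elim: (index_enum _) => [|i r [sr IH]].
  rewrite (_ : (fun _ => _) = fun=> 0).
    by rewrite big_nil conn0; split=> //; exact: smooth_along0.
  by apply/funext => q; rewrite big_nil.
rewrite (_ : (fun _ => _) = fun q => Y i q + \sum_(j <- r) Y j q).
  rewrite (connection_add cD x (sY i) sr) IH big_cons; split; last by [].
  exact: (smooth_alongD sF (sY i) sr).
by apply/funext => q; rewrite big_cons.
Qed.

Lemma connZ p x (a : R) Y : smooth_along F p Y ->
  D p x (fun q => a *: Y q) = a *: D p x Y.
Proof.
move=> sY; have := connection_leibniz cD x (smooth_at_cst p a) sY.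
by rewrite dir_cst scale0r add0r.
Qed.

Lemma connN p x Y : smooth_along F p Y ->
  D p x (fun q => - Y q) = - D p x Y.
Proof.
move=> sY; rewrite -scaleN1r -connZ//; congr (D p x _).
by apply/funext => q; rewrite scaleN1r.
Qed.

Lemma connB p x Y Z : smooth_along F p Y -> smooth_along F p Z ->
  D p x (fun q => Y q - Z q) = D p x Y - D p x Z.
Proof.
move=> sY sZ.
by rewrite (connection_add cD x sY (smooth_alongN sF sZ)) (connN x sZ).
Qed.

Lemma conn_dir p Y (sY : smooth_along F p Y) a x y :
  D p (a *: x + y) Y = a *: D p x Y + D p y Y.
Proof. exact: (connection_linear cD). Qed.

End Connection.

(** * The curvature tensor *)

Section Curvature.
Context {R : realType} {n : nat} {N : manifold R n}.
Variable nab : N -> 'rV[R]_n -> (N -> 'rV[R]_n) -> 'rV[R]_n.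
Hypothesis cN : connection_along (fun p : N => p) nab.
Implicit Types (p q : N) (x y z : 'rV[R]_n).

(** The second derivative of the coordinate field z along the coordinate field
    y and the vector x.  Coordinate fields commute, so the curvature is its
    skew part in x and y. *)
Definition nabla2 p x y z := nab p x (fun q => nab q (ext p y q) (ext p z)).

Lemma smooth_nab_ext p y z : smooth_vf p (fun q => nab q (ext p y q) (ext p z)).
Proof.
have pp := chart_at_src p.
exact: (connection_smooth cN (smooth_ext y pp) (smooth_ext z pp)).
Qed.

Lemma curvatureE p x y z :
  curvature nab p x y z = nabla2 p x y z - nabla2 p y x z.
Proof.
rewrite /curvature /curvature_vf !ext_id bracket_ext.
rewrite (lin0 (conn_dir cN (smooth_ext z (chart_at_src p)))).
exact: subr0.
Qed.

Lemma nabla2_linear1 p y z a x x' :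
  nabla2 p (a *: x + x') y z = a *: nabla2 p x y z + nabla2 p x' y z.
Proof. by rewrite /nabla2 (conn_dir cN (smooth_nab_ext y z)). Qed.

Lemma nabla2_linear2 p x z a y y' :
  nabla2 p x (a *: y + y') z = a *: nabla2 p x y z + nabla2 p x y' z.
Proof.
pose G w := fun q => nab q (ext p w q) (ext p z).
have sG w : smooth_along id p (G w) by exact: smooth_nab_ext.
rewrite -[nabla2 p x y z]/(nab p x (G y)) -(connZ cN)//.
rewrite -[nabla2 p x y' z]/(nab p x (G y')).
rewrite -(connection_add cN)//; last first.
  by apply: (smooth_alongZ smooth_map_id (smooth_at_cst p a)); exact: sG.
apply: (conn_eq cN); first exact: sG.
apply: filterS (near_src (chart_at_src p)) => q pq.
by rewrite /G ext_linear// (conn_dir cN)//; exact: smooth_ext.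
Qed.

Lemma nabla2_linear3 p x y a z z' :
  nabla2 p x y (a *: z + z') = a *: nabla2 p x y z + nabla2 p x y z'.
Proof.
pose G w := fun q => nab q (ext p y q) (ext p w).
have sG w : smooth_along id p (G w) by exact: smooth_nab_ext.
rewrite -[nabla2 p x y z]/(nab p x (G z)) -(connZ cN)//.
rewrite -[nabla2 p x y z']/(nab p x (G z')).
rewrite -(connection_add cN)//; last first.
  by apply: (smooth_alongZ smooth_map_id (smooth_at_cst p a)); exact: sG.
apply: (conn_eq cN); first exact: sG.
apply: filterS (near_src (chart_at_src p)) => q pq.
have se w : smooth_along id q (ext p w) by exact: smooth_ext.
rewrite /G -(connZ cN)// -(connection_add cN)//; last first.
  by apply: (smooth_alongZ smooth_map_id (smooth_at_cst q a)); exact: se.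
apply: (conn_eq cN); first exact: se.
by apply: filterS (near_src pq) => r pr; rewrite ext_linear.
Qed.

Lemma curvature_linear1 p y z a x x' :
  curvature nab p (a *: x + x') y z =
  a *: curvature nab p x y z + curvature nab p x' y z.
Proof.
rewrite !curvatureE nabla2_linear1 nabla2_linear2.
exact: lincombB.
Qed.

Lemma curvature_linear3 p x y a z z' :
  curvature nab p x y (a *: z + z') =
  a *: curvature nab p x y z + curvature nab p x y z'.
Proof.
rewrite !curvatureE !nabla2_linear3.
exact: lincombB.
Qed.

End Curvature.

Section CurvatureMetric.
Context {R : realType} {n : nat} {N : manifold R n}.
Variables (g : N -> 'rV[R]_n -> 'rV[R]_n -> R) (hg : riemannian_metric g).
Variable nab : N -> 'rV[R]_n -> (N -> 'rV[R]_n) -> 'rV[R]_n.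
Hypothesis lN : levi_civita g nab.
Let cN := levi_civita_connection lN.

Lemma levi_civita_ext p x y : nab p x (ext p y) = nab p y (ext p x).
Proof.
have pp := chart_at_src p.
have := levi_civita_torsion_free lN (smooth_ext x pp) (smooth_ext y pp).
by rewrite bracket_ext !ext_id => /eqP; rewrite subr_eq0 => /eqP.
Qed.

(** The coordinate fields x and y commute, so x (y f) = y (x f) for
    f = g(z, w).  Expanding both sides by compatibility with the metric, the
    products of first derivatives cancel. *)
Lemma curvature_skew34 p x y z w :
  g p (curvature nab p x y z) w = - g p (curvature nab p x y w) z.
Proof.
have pp := chart_at_src p.
have alg (a b c d a' d' d1 d1' : R) :
    0 = a + b + (c + d) - (a' + c + (b + d')) -> d = d1 -> d' = d1' ->
    a - a' = - (d1 - d1') by lra.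
pose f := fun q => g q (ext p z q) (ext p w q).
have sf : smooth_at p f by apply: (metric_smooth hg); exact: smooth_ext.
have h u u' : dir p u (fun q => dir q (ext p u' q) f) =
    g p (nabla2 nab p u u' z) w + g p (nab p u' (ext p z)) (nab p u (ext p w)) +
    (g p (nab p u (ext p z)) (nab p u' (ext p w)) + g p z (nabla2 nab p u u' w)).
  have sn v := smooth_nab_ext cN u' v.
  rewrite (@dir_near_eq _ _ _ _ _ _ (fun q =>
      g q (nab q (ext p u' q) (ext p z)) (ext p w q) +
      g q (ext p z q) (nab q (ext p u' q) (ext p w)))); last first.
    apply: filterS (near_src pp) => q pq.
    by rewrite (levi_civita_metric lN)//; exact: smooth_ext.
  rewrite dirD; last 2 first.
  - by apply: (metric_smooth hg); [exact: sn|exact: smooth_ext].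
  - by apply: (metric_smooth hg); [exact: smooth_ext|exact: sn].
  rewrite (levi_civita_metric lN); last 2 first.
  - exact: sn.
  - exact: smooth_ext.
  rewrite (levi_civita_metric lN); last 2 first.
  - exact: smooth_ext.
  - exact: sn.
  by rewrite !ext_id.
have := dir_bracket (smooth_ext x pp) (smooth_ext y pp) sf.
rewrite bracket_ext !ext_id !h {1}/dir derive0 => e.
have s1 := Defs.metric_sym hg p z (nabla2 nab p x y w).
have s2 := Defs.metric_sym hg p z (nabla2 nab p y x w).
rewrite (curvatureE cN p x y z) (curvatureE cN p x y w).
rewrite [LHS](metricBl hg) [X in _ = - X](metricBl hg).
exact: alg e s1 s2.
Qed.

End CurvatureMetric.

(** * The pullback connection *)

Section Pullback.
Context {R : realType} {m n : nat} {M : manifold R m} {N : manifold R n}.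
Variables (F : M -> N) (sF : smooth_map F).
Variable nab : N -> 'rV[R]_n -> (N -> 'rV[R]_n) -> 'rV[R]_n.
Hypothesis cN : connection_along (fun p : N => p) nab.
Variable D : M -> 'rV[R]_m -> (M -> 'rV[R]_n) -> 'rV[R]_n.
Hypothesis hD : pullback_connection F nab D.
Let cD := pullback_is_connection hD.
Implicit Types (p q : M) (X Y : M -> 'rV[R]_m) (W : M -> 'rV[R]_n).

Let sext p e : smooth_along F p (ext (F p) e \o F).
Proof.
by apply: smooth_along_restrict => //; apply: smooth_ext; exact: chart_at_src.
Qed.

(** The terms of the Leibniz rule for W = sum_a W^a (d_a o F) split into the
    derivatives of the components and the ambient derivative of the coordinate
    field through W p. *)
Lemma pullback_expand p x W : smooth_along F p W ->
  D p x W = \row_a dir p x (along_coord F p W a)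
            + nab (F p) (dmap F p x) (ext (F p) (W p)).
Proof.
move=> sW; have FF := chart_at_src (F p).
pose T a q := along_coord F p W a q *: (ext (F p) (delta_mx 0 a) \o F) q.
have sT a : smooth_along F p (T a).
  exact: (smooth_alongZ sF (smooth_along_coord sF a sW) (@sext p _)).
rewrite (conn_eq cD x sW (along_expand sF p W)) (conn_sum sF cD x sT).
rewrite [X in X + _]row_sum_delta.
rewrite (lin_basis (L := fun w => nab (F p) (dmap F p x) (ext (F p) w))); last first.
  move=> a u w.
  have se v : smooth_along id (F p) (ext (F p) v) by exact: smooth_ext.
  rewrite -(connZ cN)// -(connection_add cN)//; last first.
    by apply: (smooth_alongZ smooth_map_id (smooth_at_cst (F p) a)); exact: se.
  apply: (conn_eq cN); first exact: se.
  by apply: filterS (near_src FF) => r pr; rewrite ext_linear.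
rewrite -big_split /=; apply: eq_bigr => a _; rewrite /T.
rewrite (connection_leibniz cD); last 2 first.
- exact: smooth_along_coord.
- exact: sext.
rewrite (pullback_restrict hD); last exact: smooth_ext.
by rewrite along_coord_id /= ext_id mxE.
Qed.

Lemma dmap_coord p x a : (dmap F p x) 0 a =
  dir p x (fun q => phi (F p) (F q) 0 a).
Proof.
have FF := chart_at_src (F p).
have -> : (fun q => phi (F p) (F q) 0 a) = (fun r => phi (F p) r 0 a) \o F by [].
rewrite dir_comp//; last exact: smooth_at_coord.
by rewrite -(chart_vecE _ _ FF) chart_vec_id.
Qed.

Lemma dir_push_coord p X Y a :
  dir p (X p) (along_coord F p (push F Y) a) =
  dir p (X p) (fun q => dir q (Y q) (fun r => phi (F p) (F r) 0 a)).
Proof.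
apply: dir_near_eq; apply: filterS (near_along_map_src sF p) => q Fq.
rewrite /along_coord chart_vecE// -dir_comp//; exact: smooth_at_coord.
Qed.

(** The bracket acts as a commutator on the components of F. *)
Lemma dmap_bracket p X Y : smooth_vf p X -> smooth_vf p Y ->
  dmap F p (bracket X Y p) =
  \row_a (dir p (X p) (along_coord F p (push F Y) a)
          - dir p (Y p) (along_coord F p (push F X) a)).
Proof.
move=> sX sY; apply/rowP => a; rewrite [RHS]mxE dmap_coord !dir_push_coord.
apply: dir_bracket => //; apply: (smooth_at_comp sF (f := fun r => phi (F p) r 0 a)).
by apply: smooth_at_coord; exact: chart_at_src.
Qed.

(** Both sides are linear over smooth functions in W (on the left because a
    bracket acts as a commutator), so W may be a coordinate field Z o F.  Then
    D_Y (Z o F) = sum_b (dF Y)^b (nabla_{d_b} Z) o F; differentiating along X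
    and antisymmetrizing, the derivatives of the coefficients give the
    components of dF [X, Y], which account for the term D_[X,Y], and the rest is
    the curvature. *)
Lemma pullback_curvature p X Y W :
  smooth_vf p X -> smooth_vf p Y -> smooth_along F p W ->
  D p (X p) (fun q => D q (Y q) W) - D p (Y p) (fun q => D q (X q) W)
  - D p (bracket X Y p) W =
  curvature nab (F p) (dmap F p (X p)) (dmap F p (Y p)) (W p).
Proof.
move=> sX sY; move: W.
have sD Z W : smooth_vf p Z -> smooth_along F p W ->
    smooth_along F p (fun q => D q (Z q) W).
  by move=> sZ sW; exact: (connection_smooth cD).
apply: (smooth_along_ind sF).
- move=> W W' sW WW' e; rewrite -(nbhs_singleton WW') -e.
  have nD := conn_eq_near sF cD sW WW'.
  have eqE A B : smooth_vf p B ->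
      D p (A p) (fun q => D q (B q) W) = D p (A p) (fun q => D q (B q) W').
    move=> sB; apply: (conn_eq cD); first exact: sD.
    by apply: filterS nD => q; exact.
  by rewrite (eqE X Y)// (eqE Y X)// (conn_eq cD _ sW WW').
- move=> W W' sW sW' e e'.
  have addE Z Z' : smooth_vf p Z -> D p (Z' p) (fun q => D q (Z q) (fun r => W r + W' r))
      = D p (Z' p) (fun q => D q (Z q) W) + D p (Z' p) (fun q => D q (Z q) W').
    move=> sZ; rewrite -(connection_add cD); [|exact: sD..].
    apply: (conn_eq cD); first exact: (sD _ _ sZ (smooth_alongD sF sW sW')).
    apply: filterS2 (smooth_along_near sF sW) (smooth_along_near sF sW') => q s s'.
    exact: (connection_add cD).
  rewrite [RHS](linD (curvature_linear3 cN _ _ _)) [RHS]/= -e -e'.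
  rewrite (addE Y X sY) (addE X Y sX) (connection_add cD _ sW sW').
  have alg (a a' b b' c c' : 'rV[R]_n) :
    a + a' - (b + b') - (c + c') = a - b - c + (a' - b' - c').
    by apply/rowP => i; rewrite !mxE; ring.
  exact: alg.
- move=> f W sf sW e.
  have mulE Z Z' : smooth_vf p Z -> D p (Z' p) (fun q => D q (Z q) (fun r => f r *: W r))
      = dir p (Z' p) (fun q => dir q (Z q) f) *: W p + dir p (Z p) f *: D p (Z' p) W
      + (dir p (Z' p) f *: D p (Z p) W + f p *: D p (Z' p) (fun q => D q (Z q) W)).
    move=> sZ; have sZf : smooth_at p (fun q => dir q (Z q) f) by exact: sZ.
    rewrite -(connection_leibniz cD (Z' p) sZf sW).
    rewrite -(connection_leibniz cD (Z' p) sf (sD Z W sZ sW)).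
    rewrite -(connection_add cD); last 2 first.
    + exact: (smooth_alongZ sF sZf sW).
    + exact: (smooth_alongZ sF sf (sD Z W sZ sW)).
    apply: (conn_eq cD); first exact: (sD _ _ sZ (smooth_alongZ sF sf sW)).
    apply: filterS2 (smooth_at_near sf) (smooth_along_near sF sW) => q sfq sWq.
    exact: (connection_leibniz cD).
  rewrite (mulE Y X sY) (mulE X Y sX).
  rewrite (connection_leibniz cD (bracket X Y p) sf sW) (dir_bracket sX sY sf).
  rewrite [RHS](linZ (curvature_linear3 cN _ _ _)) [RHS]/= -e.
  have alg (w dx dy dxy dyx db : 'rV[R]_n) (fxy fyx fx fy f0 : R) :
    fxy *: w + fy *: dx + (fx *: dy + f0 *: dxy) -
    (fyx *: w + fx *: dy + (fy *: dx + f0 *: dyx)) -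
    ((fxy - fyx) *: w + f0 *: db) = f0 *: (dxy - dyx - db).
    by apply/rowP => i; rewrite !mxE; ring.
  exact: alg.
move=> e; have FF := chart_at_src (F p).
pose Z := ext (F p) e; pose G y := fun r => nab r (ext (F p) y r) Z.
have sG y : smooth_vf (F p) (G y) by exact: smooth_nab_ext.
have sZ q : src (F p) (F q) -> smooth_vf (F q) Z by exact: smooth_ext.
have h A B : smooth_vf p A -> smooth_vf p B ->
    D p (A p) (fun q => D q (B q) (Z \o F)) =
    \sum_b dir p (A p) (along_coord F p (push F B) b) *: G (delta_mx 0 b) (F p)
    + nabla2 nab (F p) (dmap F p (A p)) (dmap F p (B p)) e.
  move=> sA sB; have sFB := smooth_along_push sF sB.
  pose T b q := along_coord F p (push F B) b q *: (G (delta_mx 0 b) \o F) q.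
  have sT b : smooth_along F p (T b).
    have sGF := smooth_along_restrict sF (sG (delta_mx 0 b)).
    exact: (smooth_alongZ sF (smooth_along_coord sF b sFB) sGF).
  have nT : \forall q \near p, D q (B q) (Z \o F) = \sum_b T b q.
    apply: filterS2 (near_along_map_src sF p) (along_expand sF p (push F B)) => q Fq Bq.
    rewrite (pullback_restrict hD); last exact: sZ.
    rewrite -[dmap F q (B q)]/(push F B q) Bq.
    by rewrite (lin_comb (conn_dir cN (sZ q Fq))).
  have sDB : smooth_along F p (fun q => D q (B q) (Z \o F)).
    by apply: sD; [exact: sB|exact: sext].
  rewrite (conn_eq cD (A p) sDB nT) (conn_sum sF cD (A p) sT).
  rewrite (lin_basis (nabla2_linear2 cN (F p) (dmap F p (A p)) e)) -big_split /=.
  apply: eq_bigr => b _; rewrite /T (connection_leibniz cD); last 2 first.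
  - exact: smooth_along_coord.
  - exact: smooth_along_restrict.
  rewrite (pullback_restrict hD); last exact: sG.
  by rewrite along_coord_id.
pose S A B := \sum_b dir p (A p) (along_coord F p (push F B) b)
  *: G (delta_mx 0 b) (F p).
have eS : nab (F p) (dmap F p (bracket X Y p)) Z = S X Y - S Y X.
  rewrite (lin_basis (conn_dir cN (sZ p FF))) /S -sumrB; apply: eq_bigr => b _.
  by rewrite (dmap_bracket sX sY) mxE scalerBl /G ext_id.
rewrite (h X Y sX sY) (h Y X sY sX) (pullback_restrict hD _ (sZ p FF)) eS.
have -> : (ext (F p) e \o F) p = e by exact: ext_id.
rewrite (curvatureE cN).
have alg (a b c c' : 'rV[R]_n) : a + c - (b + c') - (a - b) = c - c'.
  by apply/rowP => i; rewrite !mxE; ring.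
exact: alg.
Qed.

(** By [pullback_expand], the derivatives of the components contribute
    dF [X, Y], and the remaining terms cancel because coordinate fields of the
    ambient manifold commute. *)
Lemma pullback_torsion_free g (lN : levi_civita g nab) p X Y :
  smooth_vf p X -> smooth_vf p Y ->
  D p (X p) (push F Y) - D p (Y p) (push F X) = dmap F p (bracket X Y p).
Proof.
move=> sX sY; rewrite (dmap_bracket sX sY).
rewrite (pullback_expand (X p) (smooth_along_push sF sY)).
rewrite (pullback_expand (Y p) (smooth_along_push sF sX)).
have e := levi_civita_ext lN (F p) (dmap F p (Y p)) (push F X p).
rewrite {}e.
have alg (u w : 'I_n -> R) (c : 'rV[R]_n) :
    \row_a u a + c - (\row_a w a + c) = \row_a (u a - w a).
  by apply/rowP => a; rewrite !mxE; ring.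
exact: alg.
Qed.

(** The defect of metric compatibility is linear over smooth functions in each
    argument, and it vanishes on coordinate fields. *)
Lemma pullback_metric g (hg : riemannian_metric g) (lN : levi_civita g nab)
    p x W W' : smooth_along F p W -> smooth_along F p W' ->
  dir p x (fun q => g (F q) (W q) (W' q)) =
  g (F p) (D p x W) (W' p) + g (F p) (W p) (D p x W').
Proof.
pose P W W' := dir p x (fun q => g (F q) (W q) (W' q)) =
  g (F p) (D p x W) (W' p) + g (F p) (W p) (D p x W').
have Psym W1 W2 : P W1 W2 -> P W2 W1.
  rewrite /P (Defs.metric_sym hg _ (D p x W1)) (Defs.metric_sym hg _ (W1 p)) => e.
  rewrite addrC -e; apply: dir_near_eq; apply: nearW => q.
  exact: Defs.metric_sym.
have ind W2 : smooth_along F p W2 -> (forall e, P (ext (F p) e \o F) W2) ->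
    forall W1, smooth_along F p W1 -> P W1 W2.
  move=> s2 Pext; apply: (smooth_along_ind sF); last exact: Pext.
  - move=> Y Z sY YZ; rewrite /P => e; rewrite -(conn_eq cD x sY YZ).
    rewrite -(nbhs_singleton YZ) -e; apply: dir_near_eq.
    by apply: filterS YZ => q ->.
  - move=> Y Z sY sZ; rewrite /P => eY eZ.
    rewrite (connection_add cD)// !(metricDl hg) addrACA -eY -eZ.
    rewrite -dirD; last 2 first.
    + exact: smooth_metric_along.
    + exact: smooth_metric_along.
    by apply: dir_near_eq; apply: nearW => q; exact: metricDl.
  - move=> f Y sf sY; rewrite /P => eY.
    rewrite (connection_leibniz cD)// (metricDl hg) !(metricZl hg) -addrA -mulrDr -eY.
    rewrite -dirM//; last exact: smooth_metric_along.
    by apply: dir_near_eq; apply: nearW => q; exact: metricZl.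
move=> sW sW'; apply: (ind _ sW' _ _ sW) => e; apply: Psym.
apply: (ind _ (@sext p e) _ _ sW') => e'.
have FF := chart_at_src (F p).
have sZ u : smooth_vf (F p) (ext (F p) u) by exact: smooth_ext.
rewrite /P (pullback_restrict hD x (sZ e)) (pullback_restrict hD x (sZ e')).
rewrite -(levi_civita_metric lN (dmap F p x) (sZ e') (sZ e)).
exact: (dir_comp sF x (metric_smooth hg (sZ e') (sZ e))).
Qed.

End Pullback.

(** * Orthonormal bases and traces *)

Section OrthonormalBases.
Context {R : realType} {m : nat}.
Variable G : 'rV[R]_m -> 'rV[R]_m -> R.
Hypothesis linl : forall z a x y, G (a *: x + y) z = a * G x z + G y z.
Hypothesis Gsym : forall x y, G x y = G y x.

Let linr z a x y : G z (a *: x + y) = a * G z x + G z y.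
Proof. by rewrite !(Gsym z) linl. Qed.

Let gram : 'M[R]_m := \matrix_(a, b) G (delta_mx 0 a) (delta_mx 0 b).

Let gramE x y : (x *m gram *m y^T) 0 0 = G x y.
Proof.
have -> : G x y = \sum_b y 0 b * G x (delta_mx 0 b).
  exact: (@lin_basis R _ R^o (G x) (linr x)).
rewrite mxE; apply: eq_bigr => b _; rewrite [in RHS]mulrC mxE; congr (_ * _).
  rewrite (@lin_basis R _ R^o (G ^~ (delta_mx 0 b)) (linl _)).
  by apply: eq_bigr => a _; rewrite mxE.
by rewrite mxE.
Qed.

(** The matrix A with rows e_i satisfies A Q A^T = 1, where Q is the Gram matrix
    of the standard basis; since A is square, Q A^T A = 1 as well, which is the
    claimed expansion. *)
Lemma orthonormal_expand (e : 'I_m -> 'rV[R]_m) x :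
  (forall i j, G (e i) (e j) = (i == j)%:R) ->
  x = \sum_i G x (e i) *: e i.
Proof.
move=> he; pose A : 'M[R]_m := \matrix_i e i.
have AA : A *m (gram *m A^T) = 1%:M.
  apply/matrixP => i j; rewrite [RHS]mxE -he -gramE mulmxA.
  rewrite -[LHS]/((A *m gram *m A^T) i j) -(rowK e i) -(rowK e j) -/A.
  by rewrite tr_row -row_mul !mxE; apply: eq_bigr => k _; rewrite !mxE.
rewrite -{1}[x]mulmx1 -(mulmx1C AA) !mulmxA mulmx_sum_row.
apply: eq_bigr => i _; rewrite rowK; congr (_ *: _).
rewrite -gramE [LHS]mxE [RHS]mxE; apply: eq_bigr => k _.
by congr (_ * _); rewrite !mxE.
Qed.

(** The trace of a bilinear map is invariant under orthogonal changes of
    basis. *)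
Lemma orthonormal_trace (W : lmodType R) (B : 'rV[R]_m -> 'rV[R]_m -> W)
    (e e' : 'I_m -> 'rV[R]_m) :
  (forall z a x y, B (a *: x + y) z = a *: B x z + B y z) ->
  (forall z a x y, B z (a *: x + y) = a *: B z x + B z y) ->
  (forall i j, G (e i) (e j) = (i == j)%:R) ->
  (forall i j, G (e' i) (e' j) = (i == j)%:R) ->
  \sum_i B (e' i) (e' i) = \sum_i B (e i) (e i).
Proof.
move=> Bl Br he he'.
have Be x : B x x = \sum_j \sum_k (G x (e j) * G x (e k)) *: B (e j) (e k).
  rewrite {1 2}(orthonormal_expand x he) (lin_comb (Bl _)).
  apply: eq_bigr => j _; rewrite (lin_comb (Br _)) scaler_sumr.
  by apply: eq_bigr => k _; rewrite scalerA.
(* The matrix of the G (e' i) (e j) is orthogonal. *)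
have parseval j k : \sum_i G (e' i) (e j) * G (e' i) (e k) = (j == k)%:R.
  rewrite -he {2}(orthonormal_expand (e k) he').
  rewrite (@lin_comb R _ R^o (G (e j)) (linr _)).
  by apply: eq_bigr => i _; rewrite mulrC (Gsym (e k)) (Gsym (e j)).
under eq_bigr do rewrite Be.
rewrite exchange_big /=; apply: eq_bigr => j _; rewrite exchange_big /=.
rewrite (bigD1 j)//= -scaler_suml parseval eqxx scale1r big1 ?addr0// => k kj.
by rewrite -scaler_suml parseval eq_sym (negbTE kj) scale0r.
Qed.

End OrthonormalBases.

(** * Normal projection *)

Section Immersion.
Context {R : realType} {m n : nat} {M : manifold R m} {N : manifold R n}.
Variables (F : M -> N) (sF : smooth_map F).
Variables (gt : N -> 'rV[R]_n -> 'rV[R]_n -> R) (hgt : riemannian_metric gt).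
Implicit Types (p q : M).

Lemma is_normal_linear p a u w : is_normal F gt p u -> is_normal F gt p w ->
  is_normal F gt p (a *: u + w).
Proof. by move=> nu nw x; rewrite (metric_linear hgt) nu nw mulr0 addr0. Qed.

(** The decomposition into tangential and normal part is unique, because the
    difference of two normal parts is both normal and tangent, hence of norm
    zero. *)
Lemma perp_eq p x u : is_normal F gt p u -> perp F gt p (dmap F p x + u) = u.
Proof.
move=> nu; apply: xget_unique; first by split=> //; exists x.
move=> u' [nu' [x' e]].
have e' : u' - u = dmap F p (x - x').
  rewrite (linB (dmap_linear sF p)); apply/eqP.
  by rewrite subr_eq addrAC e [dmap F p x' + _]addrC addrK.
have : gt (F p) (u' - u) (u' - u) = 0.
  by rewrite {2}e' (metricBl hgt) nu nu' subrr.
have [/eqP|/(metric_pos hgt (F p)) + h] := eqVneq (u' - u) 0.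
  by rewrite subr_eq0 => /eqP.
by rewrite h ltxx.
Qed.

Section AtPoint.
Variables (p : M) (e : 'I_m -> 'rV[R]_m).
Hypothesis he : Defs.orthonormal (induced_metric F gt) p e.

Lemma induced_linear z a x y : induced_metric F gt p (a *: x + y) z =
  a * induced_metric F gt p x z + induced_metric F gt p y z.
Proof. by rewrite /induced_metric (dmap_linear sF) (metric_linear hgt). Qed.

Lemma induced_sym x y : induced_metric F gt p x y = induced_metric F gt p y x.
Proof. exact: (Defs.metric_sym hgt). Qed.

(** An orthonormal basis of T_pM yields the tangential part of w explicitly, so
    that [perp] selects an actual normal component. *)
Lemma perp_decomp w : exists x, w = dmap F p x + perp F gt p w
  /\ is_normal F gt p (perp F gt p w).
Proof.
pose x := \sum_i gt (F p) w (dmap F p (e i)) *: e i.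
have nu : is_normal F gt p (w - dmap F p x).
  have nui i : gt (F p) (w - dmap F p x) (dmap F p (e i)) = 0.
    rewrite (metricBl hgt) (lin_comb (dmap_linear sF p)) (metric_suml hgt).
    have he' j : gt (F p) (dmap F p (e j)) (dmap F p (e i)) = (j == i)%:R.
      exact: he.
    rewrite (bigD1 i)//= big1 => [|j ji]; last first.
      by rewrite (metricZl hgt) he' (negbTE ji) mulr0.
    by rewrite (metricZl hgt) he' eqxx mulr1 addr0 subrr.
  move=> y; rewrite (orthonormal_expand induced_linear induced_sym y he).
  move: (w - dmap F p x) nui => u nui.
  rewrite (lin_comb (dmap_linear sF p)) (metric_sumr hgt); apply: big1 => i _.
  by rewrite (metricZr hgt) nui mulr0.
have eu : perp F gt p w = w - dmap F p x.
  by rewrite -{1}[w](subrK (dmap F p x)) addrC perp_eq.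
by exists x; rewrite eu addrC subrK.
Qed.

Lemma perp_linear a u w :
  perp F gt p (a *: u + w) = a *: perp F gt p u + perp F gt p w.
Proof.
have [x [eu nu]] := perp_decomp u; have [y [ew nw]] := perp_decomp w.
rewrite {1}eu {1}ew scalerDr addrACA -(linZ (dmap_linear sF p)).
rewrite -(linD (dmap_linear sF p)) perp_eq//.
exact: is_normal_linear.
Qed.

Lemma metric_perp u w : is_normal F gt p u ->
  gt (F p) u (perp F gt p w) = gt (F p) u w.
Proof.
move=> nu; have [x [ew _]] := perp_decomp w.
by rewrite [in RHS]ew (metricDr hgt) nu add0r.
Qed.

End AtPoint.

End Immersion.

(** * The Gauss and Codazzi equations *)

Section SecondFundamentalForm.
Context {R : realType} {m n : nat} {M : manifold R m} {N : manifold R n}.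
Variables (F : M -> N) (sF : smooth_map F).
Variables (gt : N -> 'rV[R]_n -> 'rV[R]_n -> R) (hgt : riemannian_metric gt).
Variable nablat : N -> 'rV[R]_n -> (N -> 'rV[R]_n) -> 'rV[R]_n.
Hypothesis lN : levi_civita gt nablat.
Variable nabla : M -> 'rV[R]_m -> (M -> 'rV[R]_m) -> 'rV[R]_m.
Hypothesis lM : levi_civita (induced_metric F gt) nabla.
Variable D : M -> 'rV[R]_m -> (M -> 'rV[R]_n) -> 'rV[R]_n.
Hypothesis hD : pullback_connection F nablat D.
Let cN := levi_civita_connection lN.
Let cM := levi_civita_connection lM.
Let cD := pullback_is_connection hD.
Implicit Types (p q : M) (X Y Z : M -> 'rV[R]_m).

Local Notation II := (II F gt D).
Local Notation nablaB := (nablaB F gt nabla D).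
Local Notation perp := (perp F gt).
Local Notation dF := (dmap F).

Let sext p x : smooth_vf p (ext p x).
Proof. by apply: smooth_ext; exact: chart_at_src. Qed.

Let snabla p X Y : smooth_vf p X -> smooth_vf p Y ->
  smooth_vf p (fun q => nabla q (X q) Y).
Proof. exact: (connection_smooth cM). Qed.

Let sDpush p X Y : smooth_vf p X -> smooth_vf p Y ->
  smooth_along F p (fun q => D q (X q) (push F Y)).
Proof.
by move=> sX sY; apply: (connection_smooth cD) => //; exact: smooth_along_push.
Qed.

(** The exchange of X and Y changes the two terms by the same amount: D by
    dF [X, Y], and nabla by [X, Y]. *)
Lemma normal_part_sym p X Y : smooth_vf p X -> smooth_vf p Y ->
  D p (X p) (push F Y) - dF p (nabla p (X p) Y) =
  D p (Y p) (push F X) - dF p (nabla p (Y p) X).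
Proof.
move=> sX sY; have := pullback_torsion_free sF cN hD lN sX sY.
rewrite -(levi_civita_torsion_free lM sX sY) (linB (dmap_linear sF p)).
have alg (a b c d : 'rV[R]_n) : a - b = c - d -> a - c = b - d.
  by move=> e; rewrite -[a](subrK b) e; apply/rowP => i; rewrite !mxE; ring.
exact: alg.
Qed.

(** Koszul's argument: the triple product S below is symmetric in the first two
    arguments and skew in the last two, so three exchanges of each kind, applied
    alternately, bring it back to itself with the opposite sign. *)
Lemma gauss_normal p X Y : smooth_vf p X -> smooth_vf p Y ->
  is_normal F gt p (D p (X p) (push F Y) - dF p (nabla p (X p) Y)).
Proof.
move=> sX sY z; rewrite -(ext_id p z); move: (@sext p z).
move: (ext p z) => {z} Z sZ.
pose S A B C :=
  gt (F p) (D p (A p) (push F B) - dF p (nabla p (A p) B)) (dF p (C p)).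
have Ssym A B C : smooth_vf p A -> smooth_vf p B -> S A B C = S B A C.
  move=> sA sB; exact: (congr1 (gt (F p) ^~ _) (normal_part_sym sA sB)).
have alg (a b b' c d d' : R) :
    a + b = c + d -> b = b' -> d = d' -> c - a = - (d' - b') by lra.
have Santi A B C : smooth_vf p A -> smooth_vf p B -> smooth_vf p C ->
    S A B C = - S A C B.
  move=> sA sB sC; have sFB := smooth_along_push sF sB.
  have sFC := smooth_along_push sF sC.
  have eD := pullback_metric sF hD hgt lN (A p) sFB sFC.
  have eM := levi_civita_metric lM (A p) sB sC.
  have sD := Defs.metric_sym hgt (F p) (dF p (B p)) (D p (A p) (push F C)).
  have sM := Defs.metric_sym hgt (F p) (dF p (B p)) (dF p (nabla p (A p) C)).
  rewrite /S [LHS](metricBl hgt) [X in _ = - X](metricBl hgt).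
  exact: alg (etrans (esym eM) eD) sM sD.
rewrite -[LHS]/(S X Y Z); clearbody S.
have h1 := Ssym X Y Z sX sY; have h2 := Santi Y X Z sY sX sZ.
have h3 := Ssym Y Z X sY sZ; have h4 := Santi Z Y X sZ sY sX.
have h5 := Ssym Z X Y sZ sX; have h6 := Santi X Z Y sX sZ sY.
by lra.
Qed.

Lemma IIE p X Y : smooth_vf p X -> smooth_vf p Y ->
  II X Y p = D p (X p) (push F Y) - dF p (nabla p (X p) Y).
Proof.
move=> sX sY; rewrite /Defs.II.
rewrite -{1}[D p _ _](subrK (dF p (nabla p (X p) Y))) addrC.
by rewrite (perp_eq sF hgt)//; exact: gauss_normal.
Qed.

Lemma II_normal p X Y : smooth_vf p X -> smooth_vf p Y ->
  is_normal F gt p (II X Y p).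
Proof. by move=> sX sY; rewrite IIE//; exact: gauss_normal. Qed.

Lemma near_smooth_vf p X : smooth_vf p X -> \forall q \near p, smooth_vf q X.
Proof. exact: (smooth_along_near smooth_map_id). Qed.

Lemma near_IIE p X Y : smooth_vf p X -> smooth_vf p Y -> \forall q \near p,
  II X Y q = D q (X q) (push F Y) - dF q (nabla q (X q) Y).
Proof.
move=> /near_smooth_vf nX /near_smooth_vf nY.
by apply: filterS2 nX nY => q; exact: IIE.
Qed.

Lemma smooth_II p X Y : smooth_vf p X -> smooth_vf p Y ->
  smooth_along F p (II X Y).
Proof.
move=> sX sY.
have sB := smooth_alongB sF (sDpush sX sY) (smooth_along_push sF (snabla sX sY)).
by apply: smooth_along_eq sB; apply: filterS (near_IIE sX sY) => q ->.
Qed.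

Lemma II_sym p X Y : smooth_vf p X -> smooth_vf p Y -> II X Y p = II Y X p.
Proof.
move=> sX sY.
by rewrite (IIE sX sY) (IIE sY sX); exact: normal_part_sym.
Qed.

Lemma near_II_sym p X Y : smooth_vf p X -> smooth_vf p Y ->
  \forall q \near p, II X Y q = II Y X q.
Proof.
move=> /near_smooth_vf nX /near_smooth_vf nY.
by apply: filterS2 nX nY => q; exact: II_sym.
Qed.

(** II is a tensor: it visibly depends on its first argument through the value
    at p, hence by symmetry also on the second. *)
Lemma II_ext p X Y : smooth_vf p X -> smooth_vf p Y ->
  II X Y p = II (ext p (X p)) (ext p (Y p)) p.
Proof.
have dirE A B : II A B p = II (ext p (A p)) B p by rewrite /Defs.II ext_id.
move=> sX sY; rewrite dirE (II_sym (@sext p _) sY) dirE.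
by apply: II_sym; exact: sext.
Qed.

Lemma II_ext_linear1 p z a x y :
  II (ext p (a *: x + y)) (ext p z) p =
  a *: II (ext p x) (ext p z) p + II (ext p y) (ext p z) p.
Proof.
have IIe u : II (ext p u) (ext p z) p =
    D p u (push F (ext p z)) - dF p (nabla p u (ext p z)).
  by rewrite (IIE (@sext p u) (@sext p z)) ext_id.
apply: (etrans (IIe _)).
rewrite (conn_dir cD (smooth_along_push sF (@sext p z))).
rewrite (conn_dir cM (@sext p z)) (dmap_linear sF).
apply: (etrans (lincombB _ _ _ _ _)).
exact: (congr2 (fun u v => a *: u + v) (esym (IIe x)) (esym (IIe y))).
Qed.

Lemma II_ext_linear2 p z a x y :
  II (ext p z) (ext p (a *: x + y)) p =
  a *: II (ext p z) (ext p x) p + II (ext p z) (ext p y) p.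
Proof.
have sym u : II (ext p z) (ext p u) p = II (ext p u) (ext p z) p.
  by apply: II_sym; exact: sext.
apply: (etrans (sym _)); apply: (etrans (II_ext_linear1 p z a x y)).
exact: (congr2 (fun u v => a *: u + v) (esym (sym x)) (esym (sym y))).
Qed.

Lemma nablaB_II_sym p X Y Z :
  smooth_vf p X -> smooth_vf p Y -> smooth_vf p Z ->
  nablaB II X Y Z p = nablaB II X Z Y p.
Proof.
move=> sX sY sZ.
have e1 := conn_eq cD (X p) (smooth_II sY sZ) (near_II_sym sY sZ).
have e2 := II_sym (snabla sX sY) sZ; have e3 := II_sym sY (snabla sX sZ).
have alg (a a' b b' c c' : 'rV[R]_n) :
  a = a' -> b = b' -> c = c' -> a - b - c = a' - c' - b'.
  by move=> -> -> ->; rewrite addrAC.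
exact: alg (congr1 (perp p) e1) e2 e3.
Qed.

(** The derivative of II(Y, Z) is that of D_Y (dF Z) minus that of
    dF (nabla_Y Z), and the normal part of the latter is again a value of II. *)
Lemma nablaB_IIE p (e : 'I_m -> 'rV[R]_m) X Y Z :
  Defs.orthonormal (induced_metric F gt) p e ->
  smooth_vf p X -> smooth_vf p Y -> smooth_vf p Z ->
  nablaB II X Y Z p =
  perp p (D p (X p) (fun q => D q (Y q) (push F Z)))
  - II X (fun q => nabla q (Y q) Z) p
  - II (fun q => nabla q (X q) Y) Z p - II Y (fun q => nabla q (X q) Z) p.
Proof.
move=> he sX sY sZ; rewrite /Defs.nablaB /nabla_perp.
have sYZ := smooth_along_push sF (snabla sY sZ).
rewrite (conn_eq cD (X p) (smooth_II sY sZ) (near_IIE sY sZ)).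
rewrite (connB sF cD (X p) (sDpush sY sZ) sYZ).
by rewrite (linB (perp_linear sF hgt he)).
Qed.

(** In [nablaB_IIE] for (X, Y, Z) and (Y, X, Z), the terms II(X, nabla_Y Z) and
    II(Y, nabla_X Z) cancel, the terms with nabla_X Y and nabla_Y X combine into
    the normal part of D_[X,Y] (dF Z), and the second derivatives of dF Z then
    make up the curvature of D. *)
Lemma codazzi p (e : 'I_m -> 'rV[R]_m) X Y Z :
  Defs.orthonormal (induced_metric F gt) p e ->
  smooth_vf p X -> smooth_vf p Y -> smooth_vf p Z ->
  nablaB II X Y Z p = nablaB II Y X Z p +
    perp p (curvature nablat (F p) (dF p (X p)) (dF p (Y p)) (dF p (Z p))).
Proof.
move=> he sX sY sZ; have sFZ := smooth_along_push sF sZ.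
have := pullback_curvature sF cN hD sX sY sFZ; rewrite /push => <-.
rewrite (nablaB_IIE he sX sY sZ) (nablaB_IIE he sY sX sZ).
rewrite !(linB (perp_linear sF hgt he)).
have -> : perp p (D p (bracket X Y p) (push F Z)) =
    II (fun q => nabla q (X q) Y) Z p - II (fun q => nabla q (Y q) X) Z p.
  rewrite -(linB (perp_linear sF hgt he)) -(levi_civita_torsion_free lM sX sY).
  by rewrite (linB (conn_dir cD sFZ)).
have alg (a b c d f g : 'rV[R]_n) :
    a - c - d - f = b - f - g - c + (a - b - (d - g)).
  by apply/rowP => i; rewrite !mxE; ring.
exact: alg.
Qed.

End SecondFundamentalForm.

(** * The traced Codazzi equation *)

Section Trace.
Context {R : realType} {m n : nat} {M : manifold R m} {N : manifold R n}.
Variables (F : M -> N) (sF : smooth_map F).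
Variables (gt : N -> 'rV[R]_n -> 'rV[R]_n -> R) (hgt : riemannian_metric gt).
Variable nablat : N -> 'rV[R]_n -> (N -> 'rV[R]_n) -> 'rV[R]_n.
Hypothesis lN : levi_civita gt nablat.
Variable nabla : M -> 'rV[R]_m -> (M -> 'rV[R]_m) -> 'rV[R]_m.
Hypothesis lM : levi_civita (induced_metric F gt) nabla.
Variable D : M -> 'rV[R]_m -> (M -> 'rV[R]_n) -> 'rV[R]_n.
Hypothesis hD : pullback_connection F nablat D.
Variables (U : set M) (oU : open U) (E : 'I_m -> M -> 'rV[R]_m).
Hypothesis hE : on_frame (induced_metric F gt) U E.
Let cM := levi_civita_connection lM.
Let cD := pullback_is_connection hD.
Implicit Types (p q : M) (X Y Z : M -> 'rV[R]_m).

Local Notation II := (II F gt D).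
Local Notation nablaB := (nablaB F gt nabla D).
Local Notation perp := (perp F gt).
Local Notation dF := (dmap F).
Local Notation g := (induced_metric F gt).

Let sE p i : U p -> smooth_vf p (E i).
Proof. by move=> Up; exact: (proj1 (hE Up)). Qed.

Let nearU p : U p -> \forall q \near p, U q.
Proof. by move=> Up; exact: open_nbhs_nbhs. Qed.

(** Differentiate the constants g(E_i, E_j). *)
Lemma frame_cov_skew p x i j : U p ->
  g p (nabla p x (E i)) (E j p) = - g p (nabla p x (E j)) (E i p).
Proof.
move=> Up; have := levi_civita_metric lM x (sE i Up) (sE j Up).
rewrite (@dir_near_eq _ _ _ _ _ _ (cst (i == j)%:R)); last first.
  by apply: filterS (nearU Up) => q Uq; exact: (proj2 (hE Uq)).
rewrite dir_cst (induced_sym F hgt p (E i p)).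
by move=> e; apply/eqP; rewrite -addr_eq0 -e.
Qed.

(** The contraction of the skew g(nabla_v E_i, E_j) with the symmetric
    II(E_i, E_j). *)
Lemma sum_II_cov p v : U p -> smooth_vf p v ->
  \sum_i II (fun q => nabla q (v q) (E i)) (E i) p = 0.
Proof.
move=> Up sv.
pose w i j := g p (nabla p (v p) (E i)) (E j p).
pose B i j := II (ext p (E i p)) (ext p (E j p)) p.
have -> : \sum_i II (fun q => nabla q (v q) (E i)) (E i) p =
    \sum_i \sum_j w i j *: B j i.
  apply: eq_bigr => i _.
  have sn : smooth_vf p (fun q => nabla q (v q) (E i)).
    exact: (connection_smooth cM sv (sE i Up)).
  rewrite (II_ext sF hgt lN lM hD sn (sE i Up)).
  rewrite {1}(orthonormal_expand (induced_linear sF hgt _)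
    (induced_sym F hgt _) (nabla p (v p) (E i)) (proj2 (hE Up))).
  by rewrite (lin_comb (II_ext_linear1 sF hgt lN lM hD p _)).
set S := (X in X = 0); have SN : S = - S.
  rewrite {1}/S exchange_big /= -sumrN; apply: eq_bigr => i _.
  rewrite -sumrN; apply: eq_bigr => j _.
  have -> : w j i = - w i j by exact: (frame_cov_skew (v p) j i Up).
  have -> : B i j = B j i.
    by apply: (II_sym sF hgt lN lM hD); apply: smooth_ext; exact: chart_at_src.
  exact: scaleNr.
by apply/rowP => a; move/rowP : SN => /(_ a); rewrite !mxE; lra.
Qed.

(** The frame in the definition may vary from point to point, but at each point
    the trace of a bilinear map does not depend on the orthonormal basis. *)
Lemma mean_curvature_vectorE q : U q ->
  mean_curvature_vector F gt D q = (m%:R)^-1 *: \sum_i II (E i) (E i) q.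
Proof.
move=> Uq; apply: (congr1 (fun w => (m%:R)^-1 *: w)).
(* The frame E shows that frames exist near q, so that the chosen one is a frame. *)
have [V qV hV] : [set E | exists2 U, open_nbhs q U & on_frame g U E]
    (local_frame g q).
  by apply: (xgetPex _ (ex_intro _ E _)); exists U.
have Vq : V q by case: qV.
have tr (E' : 'I_m -> M -> 'rV[R]_m) (sE' : forall i, smooth_vf q (E' i)) :
    \sum_i II (E' i) (E' i) q =
    \sum_i II (ext q (E' i q)) (ext q (E' i q)) q.
  by apply: eq_bigr => i _; exact: (II_ext sF hgt lN lM hD (sE' i) (sE' i)).
apply: (etrans (tr _ (proj1 (hV _ Vq)))).
apply: (etrans _ (esym (tr _ (proj1 (hE Uq))))).
apply: (@orthonormal_trace _ _ (g q) (induced_linear sF hgt _)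
  (induced_sym F hgt _) _ (fun x y => II (ext q x) (ext q y) q)
  (fun i => E i q)).
- exact: (II_ext_linear1 sF hgt lN lM hD).
- exact: (II_ext_linear2 sF hgt lN lM hD).
- exact: (proj2 (hE Uq)).
- exact: (proj2 (hV _ Vq)).
Qed.

Lemma smooth_mean_curvature_vector p : U p ->
  smooth_along F p (mean_curvature_vector F gt D).
Proof.
move=> Up; have sS : smooth_along F p
    (fun q => (m%:R : R)^-1 *: \sum_i II (E i) (E i) q).
  apply: (smooth_alongZ sF (smooth_at_cst p ((m%:R : R)^-1))).
  apply: (smooth_along_sum sF) => i.
  exact: (smooth_II sF hgt lN lM hD (sE i Up) (sE i Up)).
apply: smooth_along_eq sS.
by apply: filterS (nearU Up) => q Uq; rewrite mean_curvature_vectorE.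
Qed.

Lemma mean_curvature_vector_normal p : U p ->
  is_normal F gt p (mean_curvature_vector F gt D p).
Proof.
move=> Up x; rewrite mean_curvature_vectorE// (metricZl hgt) (metric_suml hgt).
rewrite big1 ?mulr0// => i _.
exact: (II_normal sF hgt lN lM hD (sE i Up) (sE i Up)).
Qed.

(** Both corrections in the definition of nabla^B_v II have trace zero by
    [sum_II_cov]. *)
Lemma trace_nablaB_II p v : U p -> smooth_vf p v ->
  \sum_i nablaB II v (E i) (E i) p =
  m%:R *: nabla_perp F gt D p (v p) (mean_curvature_vector F gt D).
Proof.
move=> Up sv.
(* The factor m cancels its inverse in the mean curvature vector only if it is
   nonzero; for m = 0 all sums are empty. *)
have [m0|m_gt0] := posnP m.
  have -> : (m%:R : R) = 0 by rewrite m0.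
  rewrite scale0r big1// => i _.
  by have := ltn_ord i; rewrite [X in (_ < X)%N]m0.
have sII i := smooth_II sF hgt lN lM hD (sE i Up) (sE i Up).
have pl := perp_linear sF hgt (proj2 (hE Up)).
have -> : nabla_perp F gt D p (v p) (mean_curvature_vector F gt D) =
    (m%:R)^-1 *: \sum_i perp p (D p (v p) (II (E i) (E i))).
  rewrite /nabla_perp -(lin_sum pl) -(linZ pl); congr (perp p _).
  rewrite -(conn_sum sF cD (v p) sII) -(connZ cD); last first.
    exact: smooth_along_sum.
  apply: (conn_eq cD); first exact: smooth_mean_curvature_vector.
  by apply: filterS (nearU Up) => q Uq; rewrite mean_curvature_vectorE.
rewrite scalerA mulfV ?pnatr_eq0 -?lt0n// scale1r.
have cov0 := sum_II_cov Up sv.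
have cov0' : \sum_i II (E i) (fun q => nabla q (v q) (E i)) p = 0.
  apply: (etrans _ cov0); apply: eq_bigr => i _.
  apply: (II_sym sF hgt lN lM hD); first exact: sE.
  exact: (connection_smooth cM sv (sE i Up)).
have alg (t a b : 'I_m -> 'rV[R]_n) : \sum_i a i = 0 -> \sum_i b i = 0 ->
    \sum_i (t i - a i - b i) = \sum_i t i.
  by move=> a0 b0; rewrite !sumrB a0 b0 !subr0.
exact: alg cov0 cov0'.
Qed.

(** Trace of [codazzi], after exchanging the last two arguments of
    nabla^B II. *)
Theorem tr_nablaB_II_codazzi p v : U p -> smooth_vf p v ->
  tr_nablaB_II F gt nabla D E v p =
  m%:R *: nabla_perp F gt D p (v p) (mean_curvature_vector F gt D)
  + \sum_i perp p (curvature nablat (F p) (dF p (E i p)) (dF p (v p))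
                   (dF p (E i p))).
Proof.
move=> Up sv; rewrite -trace_nablaB_II// -big_split /=.
apply: eq_bigr => i _.
rewrite (nablaB_II_sym sF hgt lN lM hD (sE i Up) (sE i Up) sv).
exact: (codazzi sF hgt lN lM hD (proj2 (hE Up)) (sE i Up) sv (sE i Up)).
Qed.

End Trace.

(** * Hypersurfaces *)

(** The given basis shows that the basis chosen by [onb] is orthonormal, and the
    trace does not depend on the basis. *)
Lemma ricci_trace {R : realType} {n : nat} {N : manifold R n}
    (gt : N -> 'rV[R]_n -> 'rV[R]_n -> R) (hgt : riemannian_metric gt)
    (nab : N -> 'rV[R]_n -> (N -> 'rV[R]_n) -> 'rV[R]_n)
    (cN : connection_along (fun p : N => p) nab)
    (p : N) (e : 'I_n -> 'rV[R]_n) x y :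
  Defs.orthonormal gt p e ->
  ricci gt nab p x y = \sum_a gt p (curvature nab p (e a) x y) (e a).
Proof.
move=> he; have ho : Defs.orthonormal gt p (onb gt p).
  exact: (xgetPex _ (ex_intro _ e he)).
apply: (@orthonormal_trace R n (gt p) _ _ R^o
  (fun z w => gt p (curvature nab p z x y) w)) he ho.
- by move=> z a u w; rewrite (metric_linear hgt).
- exact: (Defs.metric_sym hgt).
- by move=> z a u w; rewrite (curvature_linear1 cN) (metric_linear hgt).
- by move=> z a u w; rewrite (metric_linearr hgt).
Qed.

Section Hypersurface.
Context {R : realType} {m : nat} {M : manifold R m} {N : manifold R (m + 1)}.
Variables (F : M -> N) (sF : smooth_map F).
Variables (gt : N -> 'rV[R]_(m + 1) -> 'rV[R]_(m + 1) -> R).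
Hypothesis hgt : riemannian_metric gt.
Variable nablat : N -> 'rV[R]_(m + 1) -> (N -> 'rV[R]_(m + 1)) -> 'rV[R]_(m + 1).
Hypothesis lN : levi_civita gt nablat.
Variable nabla : M -> 'rV[R]_m -> (M -> 'rV[R]_m) -> 'rV[R]_m.
Hypothesis lM : levi_civita (induced_metric F gt) nabla.
Variable D : M -> 'rV[R]_m -> (M -> 'rV[R]_(m + 1)) -> 'rV[R]_(m + 1).
Hypothesis hD : pullback_connection F nablat D.
Variables (U : set M) (oU : open U) (E : 'I_m -> M -> 'rV[R]_m).
Hypothesis hE : on_frame (induced_metric F gt) U E.
Variable nu : M -> 'rV[R]_(m + 1).
Hypothesis hnu : unit_normal F gt nu U.
Let cN := levi_civita_connection lN.
Implicit Types (p q : M) (X Y Z : M -> 'rV[R]_m).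

Local Notation II := (II F gt D).
Local Notation nablaB := (nablaB F gt nabla D).
Local Notation perp := (perp F gt).
Local Notation dF := (dmap F).

Definition adapted_frame p (a : 'I_(m + 1)) : 'rV[R]_(m + 1) :=
  match fintype.split a with inl i => dF p (E i p) | inr _ => nu p end.

Lemma adapted_frame_lshift p i : adapted_frame p (lshift 1 i) = dF p (E i p).
Proof. by rewrite /adapted_frame -[lshift 1 i]/(unsplit (inl i)) unsplitK. Qed.

Lemma adapted_frame_rshift p i : adapted_frame p (rshift m i) = nu p.
Proof. by rewrite /adapted_frame -[rshift m i]/(unsplit (inr i)) unsplitK. Qed.

Lemma adapted_frame_orthonormal p : U p ->
  Defs.orthonormal gt (F p) (adapted_frame p).
Proof.
move=> Up; have [_ nN n1] := hnu Up; have [_ he] := hE Up.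
move=> a b; rewrite -(splitK a) -(splitK b).
case: (fintype.split a) => i; case: (fintype.split b) => j;
  rewrite ?adapted_frame_lshift ?adapted_frame_rshift.
- by rewrite (inj_eq (@lshift_inj _ _)); exact: he.
- by rewrite (Defs.metric_sym hgt) nN eq_lrshift.
- by rewrite nN eq_rlshift.
- by rewrite n1 !ord1 eqxx.
Qed.

(** Expand w in the adapted orthonormal frame: only the coefficient of the
    normal survives. *)
Lemma normal_line p w : U p -> is_normal F gt p w ->
  w = gt (F p) w (nu p) *: nu p.
Proof.
move=> Up nw.
rewrite {1}(orthonormal_expand (fun z a x y => metric_linear hgt (F p) a x y z)
  (Defs.metric_sym hgt (F p)) w (adapted_frame_orthonormal Up)).
rewrite big_split_ord /= big1 ?add0r => [|i _].
  by rewrite big_ord1 adapted_frame_rshift.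
by rewrite adapted_frame_lshift nw scale0r.
Qed.

(** The derivative of a unit normal is orthogonal to it, hence to the whole
    normal line. *)
Lemma dir_metric_nu p x W : U p -> smooth_along F p W ->
  is_normal F gt p (W p) ->
  dir p x (fun q => gt (F q) (nu q) (W q)) = gt (F p) (nu p) (D p x W).
Proof.
move=> Up sW nW; have [snu _ _] := hnu Up.
rewrite (pullback_metric sF hD hgt lN x snu sW).
have nD : gt (F p) (D p x nu) (nu p) = 0.
  have := pullback_metric sF hD hgt lN x snu snu.
  rewrite (@dir_near_eq _ _ _ _ _ _ (cst 1)) ?dir_cst; last first.
    have := open_nbhs_nbhs (conj oU Up); apply: filterS => q Uq.
    by have [] := hnu Uq.
  rewrite (Defs.metric_sym hgt _ (nu p)); lra.
by rewrite (normal_line Up nW) (metricZr hgt) nD mulr0 add0r.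
Qed.

(** The second fundamental form is normal, so [dir_metric_nu] applies to it. *)
Lemma nabla_hE p X Y Z : U p ->
  smooth_vf p X -> smooth_vf p Y -> smooth_vf p Z ->
  nabla_h F gt nabla D nu X Y Z p = gt (F p) (nu p) (nablaB II X Y Z p).
Proof.
move=> Up sX sY sZ; have [_ nN _] := hnu Up.
have sII := smooth_II sF hgt lN lM hD sY sZ.
have nII := II_normal sF hgt lN lM hD sY sZ.
rewrite /nabla_h /h /Defs.nablaB !(metricBr hgt); congr (_ - _ - _).
by rewrite (dir_metric_nu (X p) Up sII nII) (metric_perp sF hgt (proj2 (hE Up))).
Qed.

Lemma mean_curvatureE q : mean_curvature F gt D nu q =
  gt (F q) (nu q) (mean_curvature_vector F gt D q).
Proof.
by rewrite /mean_curvature /mean_curvature_vector (metricZr hgt) (metric_sumr hgt).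
Qed.

(** The inner product of [tr_nablaB_II_codazzi] with the unit normal.  In the
    Ricci curvature, traced over the adapted frame, the term of the normal is
    zero and the others are the tangential curvature terms up to sign, both by
    [curvature_skew34]. *)
Theorem div_h_codazzi p v : U p -> smooth_vf p v ->
  div_h F gt nabla D nu E v p =
  m%:R * dir p (v p) (mean_curvature F gt D nu)
  - ricci gt nablat (F p) (dF p (v p)) (nu p).
Proof.
move=> Up sv; have [_ nN _] := hnu Up; have he := proj2 (hE Up).
have sE i : smooth_vf p (E i) := proj1 (hE Up) i.
have -> : mean_curvature F gt D nu =
    (fun q => gt (F q) (nu q) (mean_curvature_vector F gt D q)).
  by apply/funext => q; exact: mean_curvatureE.
rewrite (dir_metric_nu (v p) Up); last 2 first.
- exact: (smooth_mean_curvature_vector sF hgt lN lM hD oU hE).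
- exact: (mean_curvature_vector_normal sF hgt lN lM hD oU hE).
have -> : div_h F gt nabla D nu E v p =
    gt (F p) (nu p) (tr_nablaB_II F gt nabla D E v p).
  rewrite /tr_nablaB_II (metric_sumr hgt); apply: eq_bigr => i _.
  exact: nabla_hE.
rewrite (tr_nablaB_II_codazzi sF hgt lN lM hD oU hE Up sv).
rewrite (metricDr hgt) (metricZr hgt) (metric_perp sF hgt he)//.
congr (_ + _); rewrite (metric_sumr hgt).
rewrite (ricci_trace hgt cN _ _ (adapted_frame_orthonormal Up)).
rewrite big_split_ord big_ord1 /= adapted_frame_rshift.
have ric_nu : gt (F p) (curvature nablat (F p) (nu p) (dF p (v p)) (nu p)) (nu p) = 0.
  have := curvature_skew34 hgt lN (F p) (nu p) (dF p (v p)) (nu p) (nu p).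
  by move: (gt _ _ _) => c; lra.
rewrite [X in - (_ + X)]ric_nu addr0 -sumrN; apply: eq_bigr => i _.
rewrite (metric_perp sF hgt he _ nN) (Defs.metric_sym hgt) adapted_frame_lshift.
exact: (curvature_skew34 hgt lN).
Qed.

End Hypersurface.

Theorem corollary1p7 (R : realType) (n k : nat) (hk : (1 <= k)%N)
  (M : manifold R n) (Mt : manifold R (n + k))
  (gt : Mt -> 'rV[R]_(n + k) -> 'rV[R]_(n + k) -> R)
  (hgt : riemannian_metric gt)
  (F : M -> Mt) (hF : embedding F)
  (nablat : Mt -> 'rV[R]_(n + k) -> (Mt -> 'rV[R]_(n + k)) -> 'rV[R]_(n + k))
  (hnablat : levi_civita gt nablat)
  (nabla : M -> 'rV[R]_n -> (M -> 'rV[R]_n) -> 'rV[R]_n)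
  (hnabla : levi_civita (induced_metric F gt) nabla)
  (D : M -> 'rV[R]_n -> (M -> 'rV[R]_(n + k)) -> 'rV[R]_(n + k))
  (hD : pullback_connection F nablat D)
  (v : M -> 'rV[R]_n) (hv : forall p, smooth_vf p v)
  (U : set M) (hU : open U)
  (E : 'I_n -> M -> 'rV[R]_n) (hE : on_frame (induced_metric F gt) U E) :
  (k = 1%N ->
   forall nu : M -> 'rV[R]_(n + k), unit_normal F gt nu U ->
   forall p, U p ->
     div_h F gt nabla D nu E v p =
     n%:R * dir p (v p) (mean_curvature F gt D nu)
     - ricci gt nablat (F p) (dmap F p (v p)) (nu p))
  /\
  (forall p, U p ->
     tr_nablaB_II F gt nabla D E v p =
     n%:R *: nabla_perp F gt D p (v p) (mean_curvature_vector F gt D)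
     + \sum_(i < n) perp F gt p
         (curvature nablat (F p) (dmap F p (E i p)) (dmap F p (v p))
            (dmap F p (E i p)))).
Proof.
split=> [k1|].
  subst k => nu hnu p Up.
  exact: (div_h_codazzi (embedding_smooth hF) hgt hnablat hnabla hD hU hE hnu Up).
move=> p Up.
exact: (tr_nablaB_II_codazzi (embedding_smooth hF) hgt hnablat hnabla hD hU hE Up).
Qed.
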